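(* Let $p\in[1,+\infty]$ with conjugate exponent $q$, let $m\in\mathcal P_p(\mathbb R)$ and $\mathcal X=\mathrm{supp}(m)$. Let $R\subset\mathcal P_q(\mathbb R_+)$ be nonempty and bounded, i.e. $\sup_{r\in R}\mathcal M_q(r)<+\infty$. Then $$\chi_R(m)\le\inf_{g\in\mathcal C_q^0(\mathcal Y_R)}\tilde{\mathcal J}(g)\le\inf_{(f,g)\in K}\mathcal J(f,g).$$ If in addition $R$ is convex and closed for the weak-$^*$ topology, then both inequalities are equalities, namely $$\chi_R(m)=\inf_{g\in\mathcal C_q^0(\mathcal Y_R)}\tilde{\mathcal J}(g)=\inf_{(f,g)\in K}\mathcal J(f,g).$$ In particular (in this latter case), if $(f,g)\in K$ is a minimizer of $\mathcal J$ over $K$, then $g$ is a minimizer of $\tilde{\mathcal J}$ over $\mathcal C_q^0(\mathcal Y_R)$.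
   Context: The conjugate exponent $q$ of $p$ satisfies $1/p+1/q=1$ ($q=+\infty$ if $p=1$, $q=1$ if $p=+\infty$), and $\mathbb R_+=[0,+\infty)$. For a Borel probability measure $m$ on $\mathbb R$, $\mathcal M_s(m)=\big(\int|x|^s\,\mathrm dm(x)\big)^{1/s}$ if $s<+\infty$ and $\mathcal M_\infty(m)=\sup_{x\in\mathrm{supp}(m)}|x|$; $\mathcal P_s(\mathbb R)$ (resp. $\mathcal P_s(\mathbb R_+)$) is the set of Borel probability measures on $\mathbb R$ (resp. supported in $\mathbb R_+$) with $\mathcal M_s(m)<+\infty$. $\Pi(m,R)$ is the set of Borel probability measures $\pi$ on $\mathbb R^2$ with first marginal $m$ and second marginal in $R$, and $\chi_R(m)=\sup_{\pi\in\Pi(m,R)}\int_{\mathbb R^2}xy\,\mathrm d\pi(x,y)$. For $\mathcal Z\subset\mathbb R$, $\mathcal C_s^0(\mathcal Z)$ is the space of continuous $f:\mathcal Z\to\mathbb R$ with $\|f\|_s=\sup_{x\in\mathcal Z}\frac{|f(x)|}{1+|x|^s}<+\infty$ if $s<+\infty$, and the space of bounded continuous functions with the supremum norm if $s=+\infty$. Elements of $\mathcal P_q(\mathbb R)$ are seen as elements of the topological dual $\mathcal C_q^0(\mathbb R)^*$ through $\langle r,g\rangle=\int g\,\mathrm dr$, and ''closed for the weak-$^*$ topology'' means weakly-$^*$ closed in $\mathcal C_q^0(\mathbb R)^*$. $\mathcal Y_R=\bigcup_{r\in R}\mathrm{supp}(r)$. For $g\in\mathcal C_q^0(\mathcal Y_R)$: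 $\sigma_R(g)=\sup_{r\in R}\int_{\mathcal Y_R}g\,\mathrm dr$ (each $r$ being concentrated on $\mathrm{supp}(r)\subset\mathcal Y_R$), and $g^*(x)=\sup_{y\in\mathcal Y_R}\{xy-g(y)\}\in\mathbb R\cup\{+\infty\}$ for $x\in\mathcal X$. The set $K$ consists of all $(f,g)\in\mathcal C_p^0(\mathcal X)\times\mathcal C_q^0(\mathcal Y_R)$ such that $xy\le f(x)+g(y)$ for all $(x,y)\in\mathcal X\times\mathcal Y_R$. Finally, $$\mathcal J(f,g)=\int_{\mathcal X}f\,\mathrm dm+\sigma_R(g),\qquad\tilde{\mathcal J}(g)=\int_{\mathcal X}g^*\,\mathrm dm+\sigma_R(g),$$ where $\int_{\mathcal X}g^*\,\mathrm dm\in\mathbb R\cup\{+\infty\}$ is well defined, since $g^*$ is bounded below by an $m$-integrable affine function. *)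

(* Defs.v *)
From HB Require Import structures.
From mathcomp Require Import all_boot all_order all_algebra.
From mathcomp Require Import all_classical all_reals all_analysis.

Set Implicit Arguments.
Unset Strict Implicit.
Unset Printing Implicit Defensive.

Import Order.TTheory GRing.Theory Num.Theory.
Import numFieldTopology.Exports numFieldNormedType.Exports.

Local Open Scope classical_set_scope.
Local Open Scope ring_scope.

(* A measure is a function on all sets whose values outside the sigma-algebra
   are arbitrary: equalities between measures are always stated on measurable
   sets only. *)
Notation Pr R := (probability (measurableTypeR R) R).
Notation Pr2 R := (probability (measurableTypeR R * measurableTypeR R)%type R).

Section Measures.
Context {R : realType}.
Implicit Types (s : \bar R) (m r : Pr R) (Rs : set (Pr R)).

Definition msupport m : set R :=
  [set x | forall U : set R, open U -> U x -> (0 < m U)%E].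

(* The exponent -oo never occurs, here and in weight: p, q >= 1. *)
Definition moment s m : \bar R :=
  match s with
  | t%:E => ((\int[m]_x ((`|x : R| `^ t)%R)%:E) `^ t^-1)%E
  | _ => ereal_sup [set (`|x|)%:E | x in msupport m]
  end.

Definition Pspace s : set (Pr R) := [set m | (moment s m < +oo)%E].

Definition Pspace_pos s : set (Pr R) :=
  [set m | Pspace s m /\ msupport m `<=` [set x | 0 <= x]].

Definition moment_bounded s Rs : Prop :=
  (ereal_sup [set moment s r | r in Rs] < +oo)%E.

Definition convex_measures Rs : Prop :=
  forall r0 r1 t, Rs r0 -> Rs r1 -> 0 <= t <= 1 ->
    exists2 r, Rs r & forall A : set (measurableTypeR R), measurable A ->
      r A = ((1 - t)%:E * r0 A + t%:E * r1 A)%E.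

Definition couplings m Rs : set (Pr2 R) :=
  [set pi |
    (forall A : set (measurableTypeR R), measurable A ->
       pi (A `*` setT) = m A) /\
    exists2 r, Rs r & forall B : set (measurableTypeR R), measurable B ->
       pi (setT `*` B) = r B].

Definition chi Rs m : \bar R :=
  ereal_sup [set (\int[pi]_z ((z.1 : R) * (z.2 : R))%:E)%E
            | pi in couplings m Rs].

End Measures.

Section FunctionSpaces.
Context {R : realType}.
Implicit Types (s : \bar R) (Z : set R) (f g : R -> R).

Definition weight s (x : R) : R :=
  if s is t%:E then 1 + `|x| `^ t else 1.

Definition C0norm s Z f : \bar R :=
  ereal_sup [set (`|f x| / weight s x)%:E | x in Z].

(* A function on Z is represented by any of its extensions to R: the conditions
   below, and all the functionals that follow, depend on f|_Z only. *)
Definition C0 s Z : set (R -> R) :=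
  [set f | {within Z, continuous f} /\ (C0norm s Z f < +oo)%E].

Lemma weight_gt0 s x : 0 < weight s x.
Proof. by case: s => [t| |] //=; rewrite ltr_pwDl // powR_ge0. Qed.

Lemma C0norm_ub s Z f x : Z x -> ((`|f x| / weight s x)%:E <= C0norm s Z f)%E.
Proof. by move=> Zx; apply: ereal_sup_ubound; exists x. Qed.

Lemma C0normD s Z f g :
  (C0norm s Z (f \+ g)%R <= C0norm s Z f + C0norm s Z g)%E.
Proof.
apply: ge_ereal_sup => _ [x Zx <-].
apply: le_trans (leeD (C0norm_ub s f Zx) (C0norm_ub s g Zx)).
rewrite -EFinD lee_fin -mulrDl ler_wpM2r ?ler_normD//.
by rewrite invr_ge0 ltW// weight_gt0.
Qed.

Definition C0pred s : {pred R -> R} := mem (C0 s setT).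

Record C0R s := MkC0R { C0fun :> R -> R ; C0funP : C0fun \in C0pred s }.

HB.instance Definition _ s := [isSub for @C0fun s].
HB.instance Definition _ s := [Choice of C0R s by <:].

Lemma C0norm_ge0 s f : (0 <= C0norm s setT f)%E.
Proof.
apply: le_trans (C0norm_ub (Z := setT) s f (x := 0) I).
by rewrite lee_fin divr_ge0// ltW// weight_gt0.
Qed.

Lemma C0normZ s a f : C0norm s setT (a \*o f) = (`|a|%:E * C0norm s setT f)%E.
Proof.
rewrite /C0norm; have [->|a0] := eqVneq a 0.
  rewrite normr0 mul0e (_ : [set _ | _ in _] = [set 0%E]) ?ereal_sup1//.
  apply/seteqP; split => [_ [x _ <-]|_ ->] /=; last exists 0 => //;
    by rewrite /= mul0r normr0 mul0r.
apply/eqP; rewrite eq_le; apply/andP; split.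
  apply: ge_ereal_sup => _ [x _ <-].
  rewrite /= normrM -mulrA EFinM lee_wpmul2l ?lee_fin//.
  exact: C0norm_ub.
rewrite -lee_pdivlMl ?normr_gt0//.
apply: ge_ereal_sup => _ [x _ <-].
rewrite lee_pdivlMl ?normr_gt0//.
rewrite -EFinM mulrA -normrM.
by apply: ereal_sup_ubound; exists x.
Qed.

Lemma C0_submod_closed s : submod_closed (C0pred s).
Proof.
split.
  apply: mem_set; split; first by apply: continuous_subspaceT => x; exact: cst_continuous.
  rewrite (_ : C0norm _ _ _ = 0%E)// /C0norm.
  rewrite (_ : [set _ | _ in _] = [set 0%E]) ?ereal_sup1//.
  apply/seteqP; split => [_ [x _ <-]|_ ->] /=; last exists 0 => //;
    by rewrite /= normr0 mul0r.
move=> a f g /set_mem[cf nf] /set_mem[cg ng]; apply: mem_set; split.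
  move/(iffRL (continuous_subspace_setT _)) : cf => cf.
  move/(iffRL (continuous_subspace_setT _)) : cg => cg.
  apply: continuous_subspaceT => x.
  apply: cvgD (cvgM (cvg_cst a) _) (cg x); exact: cf.
apply: le_lt_trans (C0normD _ _ (a \*o f) g) _.
rewrite C0normZ lte_add_pinfty// lte_mul_pinfty//.
Qed.

HB.instance Definition _ s :=
  GRing.isSubmodClosed.Build _ _ (C0pred s) (C0_submod_closed s).
HB.instance Definition _ s := [SubChoice_isSubLmodule of C0R s by <:].

Definition C0Rnorm s (f : C0R s) : R := fine (C0norm s setT f).

Lemma C0RnormE s (f : C0R s) : (C0Rnorm f)%:E = C0norm s setT f.
Proof.
rewrite fineK// ge0_fin_numE ?C0norm_ge0//.
by have /set_mem[] := C0funP f.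
Qed.

Lemma C0RnormD s (f g : C0R s) : C0Rnorm (f + g) <= C0Rnorm f + C0Rnorm g.
Proof. by rewrite -lee_fin EFinD !C0RnormE; exact: C0normD. Qed.

Lemma C0RnormZ s a (f : C0R s) : C0Rnorm (a *: f) = `|a| * C0Rnorm f.
Proof. by apply: EFin_inj; rewrite EFinM !C0RnormE -C0normZ. Qed.

Lemma C0Rnorm_eq0 s (f : C0R s) : C0Rnorm f = 0 -> f = 0.
Proof.
move=> f0; apply/val_inj/funext => x /=.
have := C0norm_ub (Z := setT) s f (x := x) I.
rewrite -C0RnormE f0 lee_fin pmulr_lle0 ?invr_gt0 ?weight_gt0//.
by rewrite normr_le0 => /eqP.
Qed.

HB.instance Definition _ s :=
  Lmodule_isNormed.Build R (C0R s) (@C0RnormD s) (@C0RnormZ s) (@C0Rnorm_eq0 s).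

End FunctionSpaces.

(* As a subtype of {ptws V -> R^o}, the topological dual of V carries the
   topology of pointwise convergence, i.e. the weak-* topology. *)
Definition dual (R : realType) (V : normedModType R) : set {ptws V -> R^o} :=
  [set l | linear (l : V -> R^o) /\ continuous (l : V -> R^o)].
Arguments dual {R} V.

Definition measure_functionals (R : realType) (s : \bar R) (Rs : set (Pr R)) :
    set (dual (C0R s)) :=
  [set l | exists2 r, Rs r &
     forall g : C0R s, (set_val l g)%:E = (\int[r]_y (g y)%:E)%E].
Arguments measure_functionals {R} s Rs.

Definition weakstar_closed (R : realType) (s : \bar R) (Rs : set (Pr R)) :
    Prop :=
  closed (measure_functionals s Rs).

Section Duality.
Context {R : realType}.
Implicit Types (m : Pr R) (Rs : set (Pr R)) (f g : R -> R).

Definition YR Rs : set R := \bigcup_(r in Rs) msupport r.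

(* YR need not be Borel; the integral over YR is the one over msupport r,
   where r is concentrated. *)
Definition sigmaR Rs g : \bar R :=
  ereal_sup [set (\int[r]_(y in msupport r) (g y)%:E)%E | r in Rs].

Definition conj_fun Rs g (x : R) : \bar R :=
  ereal_sup [set (x * y - g y)%:E | y in YR Rs].

Definition Kset (p q : \bar R) m Rs : set ((R -> R) * (R -> R)) :=
  [set fg | [/\ C0 p (msupport m) fg.1, C0 q (YR Rs) fg.2 &
     forall x y, msupport m x -> YR Rs y -> x * y <= fg.1 x + fg.2 y]].

Definition J m Rs (fg : (R -> R) * (R -> R)) : \bar R :=
  (\int[m]_(x in msupport m) (fg.1 x)%:E + sigmaR Rs fg.2)%E.

Definition Jtilde m Rs g : \bar R :=
  (\int[m]_(x in msupport m) conj_fun Rs g x + sigmaR Rs g)%E.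

End Duality.

Definition minimizer (T : Type) (R : realType) (F : T -> \bar R) (A : set T)
    (a : T) : Prop :=
  A a /\ forall b, A b -> (F a <= F b)%E.

(* Main.v *)
Require Import Defs.
From HB Require Import structures.
From mathcomp Require Import all_boot all_order all_algebra.
From mathcomp Require Import all_classical all_reals all_analysis.
From mathcomp Require Import measurable_realfun ring lra.

Import Order.TTheory GRing.Theory Num.Theory.
Import numFieldTopology.Exports numFieldNormedType.Exports.

Local Open Scope classical_set_scope.
Local Open Scope ring_scope.

(** The two inequalities are weak duality.  If pi couples m with some r in Rs,
    integrate xy <= g^c(x) + g(y), where g^c is the conjugate of g, over the
    product of the supports, which carries pi; the only delicate point is that
    the integral of g^c may be infinite ([chi_le_Jtilde]).  If (f, g) is in K,
    then g^c <= f on the support of m ([Jtilde_le_J]).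

    For the equalities it remains to show inf_K J <= chi.  There are two
    ingredients.

    One marginal.  For a fixed r in Rs, write xy as the integral of x over the
    levels t < y.  For any threshold function a, the inequality
    x <= (x - a(t))_+ + a(t) shows that
      f(x) = int_0^oo (x - a(t))_+ dt   and   g(y) = int_0^y a(t) dt
    satisfy xy <= f(x) + g(y) for y >= 0; this is where the measures of Rs are
    supported in the half line.  Equality holds at (x, y) when
    a(t) <= x for t < y and a(t) >= x for t >= y.  A threshold function with
    this property along the whole monotone coupling u |-> (X(u), Y(u)) exists,
    because X and Y, the quantile functions of m and r, are both nondecreasing.
    To get continuous functions with the right growth, t is restricted to
    [0, n] and discretized, a is clamped to a bounded interval, and the part
    x(y - n)_+ left out is dominated by a sum h(x) + k(y) of small integral
    ([tail_split], from Young's inequality when 1 < p < oo).  So up to e the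
    coupling is optimal and the dual pair, whose second component is defined on
    the whole line, is optimal for r ([near_optimal]).

    Exchanging inf and sup.  The value int f dm + int g dr is affine in r and
    in (f, g).  If chi < c < inf_K J, every pair has some r in Rs with value
    above c; since Rs is convex, an elementary minimax argument gives one r for
    finitely many pairs ([minimax_finite]).  As the moments are bounded on Rs,
    an ultrafilter on Rs has a weak-star limit, which is represented by an
    element of Rs because Rs is closed ([measure_FIP]).  So a single r has value
    at least c on all pairs, although [near_optimal] gives a pair of value less
    than c. *)

Set Implicit Arguments.
Unset Strict Implicit.

(** * Integration against measures seen through their supports *)

Section FullSets.
Context {d : measure_display} {T : measurableType d} {R : realType}.
Variables (P : probability T R) (D : set T).
Hypotheses (mD : measurable D) (PD : P (~` D) = 0%E).
Implicit Types f g : T -> R.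

Lemma full_integrable (f : T -> \bar R) : measurable_fun setT f ->
  P.-integrable D f -> P.-integrable setT f.
Proof.
move=> mf fi.
apply/(negligible_integrable (measurableC mD) measurableT mf PD).
by rewrite setTD setCK.
Qed.

Lemma full_integral (f : T -> \bar R) : P.-integrable setT f ->
  (\int[P]_(x in D) f x = \int[P]_x f x)%E.
Proof.
move=> fi; rewrite (negligible_integral (measurableC mD) measurableT fi PD).
by rewrite setTD setCK.
Qed.

Lemma full_Rintegral f : P.-integrable setT (EFin \o f) ->
  \int[P]_(x in D) f x = \int[P]_x f x.
Proof. by move=> fi; rewrite /Rintegral full_integral. Qed.

Lemma full_le_Rintegral f g : P.-integrable setT (EFin \o f) ->
  P.-integrable setT (EFin \o g) -> (forall x, D x -> f x <= g x) ->
  \int[P]_x f x <= \int[P]_x g x.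
Proof.
move=> fi gi fg; rewrite -!full_Rintegral//.
by apply: le_Rintegral => //; exact: integrableS fi || exact: integrableS gi.
Qed.

Lemma full_dominated_integrable f g : measurable_fun setT f ->
  P.-integrable setT (EFin \o g) -> (forall x, D x -> `|f x| <= g x) ->
  P.-integrable setT (EFin \o f).
Proof.
move=> mf gi fg; apply: full_integrable; first exact/measurable_EFinP.
apply: (@le_integrable _ _ _ P D mD _ (EFin \o g)) => //.
- exact/measurable_EFinP/measurable_funTS.
- by move=> x Dx /=; rewrite lee_fin (le_trans (fg x Dx))// ler_norm.
- exact: integrableS gi.
Qed.

End FullSets.

Lemma Rintegral_EFin d (T : measurableType d) (R : realType)
    (P : probability T R) (f : T -> R) : P.-integrable setT (EFin \o f) ->
  (\int[P]_x (f x)%:E)%E = (\int[P]_x f x)%:E.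
Proof.
move=> fi; rewrite /Rintegral fineK//.
exact: (integrable_fin_num measurableT fi).
Qed.

Section Marginals.
Context {d d' : measure_display}.
Context {T : measurableType d} {T' : measurableType d'}.
Context {R : realType}.
Variables (P : probability T R) (Q : probability T' R) (phi : T -> T').
Hypothesis mphi : measurable_fun setT phi.
Hypothesis lawE : forall A, measurable A -> P (phi @^-1` A) = Q A.

Lemma law_integrable (f : T' -> \bar R) : measurable_fun setT f ->
  Q.-integrable setT f -> P.-integrable setT (f \o phi).
Proof.
move=> mf /integrableP[_ fi]; apply/integrableP; split.
  exact: measurableT_comp.
rewrite -(preimage_setT phi).
rewrite -(@ge0_integral_pushforward _ _ _ _ _ _ mphi P setT
  (fun x => `|f x|%E))//.
  rewrite (@eq_measure_integral _ _ _ _ Q)//.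
  by move=> A mA _; exact: lawE.
exact: measurableT_comp.
Qed.

Lemma law_integral (f : T' -> \bar R) : measurable_fun setT f ->
  Q.-integrable setT f -> (\int[P]_x f (phi x) = \int[Q]_y f y)%E.
Proof.
move=> mf fi; rewrite -[in LHS](preimage_setT phi).
rewrite -(@integral_pushforward _ _ _ _ _ _ mphi P setT f)//.
  rewrite (@eq_measure_integral _ _ _ _ Q)//.
  by move=> A mA _; exact: lawE.
by rewrite preimage_setT; exact: law_integrable.
Qed.

Lemma law_Rintegral (f : T' -> R) : Q.-integrable setT (EFin \o f) ->
  \int[P]_x f (phi x) = \int[Q]_y f y.
Proof.
move=> fi; rewrite /Rintegral; congr fine.
exact: (law_integral (measurable_int _ fi) fi).
Qed.

End Marginals.

Section Support.
Context {R : realType}.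
Implicit Types (m : Pr R) (s : \bar R).

Lemma closed_msupport m : closed (msupport m).
Proof.
rewrite -openC openE => x /= /existsNP[U] /not_implyP[oU] /not_implyP[Ux].
move=> /negP; rewrite -leNgt => mU0; rewrite /interior.
have : nbhs x U by exact: open_nbhs_nbhs.
apply: filterS => y Uy /(_ U oU Uy); rewrite ltNge; exact/negP/negPn.
Qed.

Lemma measurable_msupport m : measurable (msupport m : set (measurableTypeR R)).
Proof. exact: (closed_measurable (@closed_msupport m)). Qed.

(** Null open sets are unions of null intervals with rational ends, of which
    there are countably many. *)
Lemma msupport_full m : m (~` msupport m) = 0%E.
Proof.
apply: measure_negligible; first exact: measurableC (measurable_msupport m).
pose I (ab : rat * rat) : set R := `]ratr ab.1, ratr ab.2[%classic.
pose F (n : nat) : set R := if (unpickle n) is Some ab then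
  if m (I ab) == 0%E then I ab else set0 else set0.
have F0 n : m.-negligible (F n : set (measurableTypeR R)).
  rewrite /F; case: unpickle => [ab|]; last exact: negligible_set0.
  case: ifPn => [/eqP mI|_]; last exact: negligible_set0.
  exists (I ab); split => //; exact: measurable_itv.
apply: negligibleS (negligible_bigcup F0).
move=> x /= /existsNP[U] /not_implyP[oU] /not_implyP[Ux].
move=> /negP; rewrite -leNgt => mU0.
have /nbhs_ballP[e /= e0 eU] : nbhs x U by exact: open_nbhs_nbhs.
have [a] := @rat_in_itvoo R (x - e) x (ltac:(by rewrite ltrBlDr ltrDl)).
have [b] := @rat_in_itvoo R x (x + e) (ltac:(by rewrite ltrDl)).
rewrite !in_itv/= => /andP[xb be] /andP[ea ax].
have [n nE] : exists n : nat, unpickle n = Some (a, b).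
  by exists (pickle (a, b)); rewrite pickleK.
exists n => //; rewrite /F nE.
have IU : I (a, b) `<=` U.
  move=> y; rewrite /I/= in_itv/= => /andP[ay yb]; apply: eU.
  by rewrite /ball/= ltr_distlC; apply/andP; split; lra.
have -> : m (I (a, b)) == 0%E.
  rewrite eq_le measure_ge0 andbT (le_trans _ mU0)// le_measure//= inE//.
    exact: measurable_itv.
  exact: open_measurable.
by rewrite /I/= in_itv/= ax xb.
Qed.

Lemma msupport_neq0 m : msupport m !=set0.
Proof.
apply/set0P/negP => /eqP m0; have := msupport_full m.
by rewrite m0 setC0 probability_setT => /eqP; rewrite onee_eq0.
Qed.

Lemma moment_pinfty_bound m : Pspace +oo m ->
  exists2 M, 0 <= M & forall x, msupport m x -> `|x| <= M.
Proof.
rewrite /Pspace/= => mfin.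
have le_moment x : msupport m x -> (`|x|%:E <= moment +oo m)%E.
  by move=> mx; apply: ereal_sup_ubound; exists x.
have [x0 mx0] := msupport_neq0 m.
have mnum : moment +oo m \is a fin_num.
  rewrite ge0_fin_numE//.
  by apply: le_trans (le_moment _ mx0); rewrite lee_fin.
exists (fine (moment +oo m)) => [|x mx].
  by rewrite fine_ge0// (le_trans _ (le_moment _ mx0))// lee_fin.
by rewrite -lee_fin fineK// le_moment.
Qed.

Lemma measurable_norm_powR t :
  measurable_fun [set: measurableTypeR R] (fun x : R => `|x| `^ t).
Proof.
by apply: (measurableT_comp (measurable_powR t)); exact: normr_measurable.
Qed.

(** [moment] is a root of the integral of a power; as the root of [+oo] is
    [+oo], a finite moment bounds the integral itself. *)
Lemma moment_integrable (t : R) m : 1 <= t -> Pspace t%:E m ->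
  m.-integrable setT (fun x => (`|x| `^ t)%:E).
Proof.
move=> t1; rewrite /Pspace/= => mfin; apply/integrableP; split.
  by apply/measurable_EFinP; exact: measurable_norm_powR.
under eq_integral => x _ do rewrite gee0_abs ?lee_fin ?powR_ge0//.
rewrite ltey; apply/eqP => my; move: mfin; rewrite my.
by rewrite poweRyr ?ltxx// invr_neq0// gt_eqF// (lt_le_trans _ t1).
Qed.

Lemma weight_integrable s m : (1 <= s)%E -> Pspace s m ->
  m.-integrable setT (fun x => (weight s x)%:E).
Proof.
case: s => [t| |] //= t1 mfin.
- rewrite (_ : (fun x : R => _) =
      (cst 1%E \+ (fun x => (`|x| `^ t)%:E))%E); last by [].
  apply: integrableD => //; last exact: moment_integrable.
  by apply: finite_measure_integrable_cst.
- by apply: finite_measure_integrable_cst.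
Qed.

Lemma le_weight (s : \bar R) : (1 <= s)%E -> s != +oo%E ->
  forall x, `|x| <= weight s x.
Proof.
case: s => [t| |] //=; rewrite lee_fin => t1 _ x.
have [x1|x1] := leP `|x| 1; first by rewrite ler_wpDr// powR_ge0.
by rewrite ler_wpDl// -[leLHS](powRr1 (normr_ge0 _)) ler_powR// ltW.
Qed.

End Support.

Section Tails.
Context {d : measure_display} {T : measurableType d} {R : realType}.

(** Dominated convergence, in the form used for truncation errors. *)
Lemma dominated_null (P : probability T R) (f_ : nat -> T -> R) (g : T -> R) :
  (forall n, measurable_fun setT (f_ n)) -> P.-integrable setT (EFin \o g) ->
  (forall n x, `|f_ n x| <= g x) ->
  (forall x, exists N, forall n, (N <= n)%N -> f_ n x = 0) ->
  forall e, 0 < e -> exists n, \int[P]_x f_ n x <= e.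
Proof.
move=> mf gi fg f0 e e0.
have mg := measurable_int _ gi.
have fcvg : {ae P, forall x, setT x -> EFin (f_ n x) @[n --> \oo] --> 0%:E}.
  apply: aeW => x _; have [N fN] := f0 x.
  by apply: cvg_near_cst; exists N => // n /= Nn; rewrite fN.
have [_ _] := @dominated_convergence _ _ _ P setT measurableT
  (fun n x => (f_ n x)%:E) (cst 0%E) (EFin \o g)
  (fun n => ltac:(exact/measurable_EFinP)) (measurable_cst _) fcvg gi
  (ltac:(by apply: aeW => x n _; rewrite lee_fin)).
rewrite integral_cst// mul0e => /fine_cvgP[_] /cvgrPdist_le/(_ e e0)[n _].
move=> /(_ n (leqnn _))/=; rewrite sub0r normrN => In; exists n.
exact: le_trans (ler_norm _) In.
Qed.

End Tails.

Section Growth.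
Context {R : realType}.
Implicit Types (m r : Pr R) (s : \bar R) (Rs : set (Pr R)) (f g : R -> R).

Lemma C0_growth s (Z : set R) f : C0 s Z f ->
  exists2 C, 0 <= C & forall x, Z x -> `|f x| <= C * weight s x.
Proof.
move=> [_ fC]; exists (Num.max 0 (fine (C0norm s Z f))).
  by rewrite le_max lexx.
move=> x Zx; rewrite -ler_pdivrMr ?weight_gt0//.
rewrite le_max; apply/orP; right; rewrite -lee_fin fineK.
  exact: C0norm_ub.
rewrite ge0_fin_numE//; apply: le_trans (C0norm_ub s f Zx).
by rewrite lee_fin divr_ge0// ltW// weight_gt0.
Qed.

Lemma growth_C0 s (Z : set R) f C : {within Z, continuous f} ->
  (forall x, Z x -> `|f x| <= C * weight s x) -> C0 s Z f.
Proof.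
move=> cf fC; split => //; apply: (@le_lt_trans _ _ C%:E); last exact: ltry.
apply: ge_ereal_sup => _ [x Zx <-]; rewrite lee_fin.
by rewrite ler_pdivrMr ?weight_gt0// fC.
Qed.

(** Growth is only required on the support: for [s = +oo] this covers the
    absolute value, which is bounded on the support but not on the line. *)
Lemma growth_integrable s m f C : (1 <= s)%E -> Pspace s m ->
  measurable_fun [set: measurableTypeR R] f ->
  (forall x, msupport m x -> `|f x| <= C * weight s x) ->
  m.-integrable setT (EFin \o f).
Proof.
move=> s1 ms mf fC.
apply: (full_dominated_integrable (measurable_msupport m) (msupport_full m) mf
  (g := fun x => C * weight s x)) => //.
have /(integrableZl measurableT C) := weight_integrable s1 ms.
by [].
Qed.

Lemma le_norm_weight s m : (1 <= s)%E -> Pspace s m ->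
  exists2 C, 0 <= C & forall x, msupport m x -> `|x| <= C * weight s x.
Proof.
move=> s1 ms; have [sy|sy] := eqVneq s +oo%E.
  move: ms; rewrite sy => /moment_pinfty_bound[M M0 mM]; exists M => // x mx.
  by rewrite /= mulr1 mM.
by exists 1 => // x _; rewrite mul1r le_weight.
Qed.

Lemma norm_integrable s m : (1 <= s)%E -> Pspace s m ->
  m.-integrable setT (fun x => (`|x : R|)%:E).
Proof.
move=> s1 ms; have [C C0 mC] := le_norm_weight s1 ms.
apply: (growth_integrable s1 ms (f := fun x => `|x|) (C := C)).
  exact: normr_measurable.
by move=> x mx; rewrite normr_id mC.
Qed.

Lemma id_integrable s m : (1 <= s)%E -> Pspace s m ->
  m.-integrable setT (fun x : R => x%:E).
Proof.
move=> s1 ms; have [C C0 mC] := le_norm_weight s1 ms.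
by apply: (growth_integrable s1 ms (f := fun x => x) (C := C)).
Qed.

Lemma uniform_weight_bound s Rs : (1 <= s)%E -> Rs `<=` Pspace s ->
  moment_bounded s Rs ->
  exists2 B, 0 <= B & forall r, Rs r -> \int[r]_x weight s x <= B.
Proof.
rewrite /moment_bounded; case: s => [t| |]//=.
- rewrite lee_fin => t1 Rss; set S := ereal_sup _ => Sfin.
  pose M := Num.max 0 (fine S).
  have t0 : 0 < t by exact: lt_le_trans t1.
  exists (1 + M `^ t) => [|r Rr]; first by rewrite addr_ge0// powR_ge0.
  have ti := moment_integrable t1 (Rss r Rr).
  rewrite RintegralD//; last exact: finite_measure_integrable_cst.
  rewrite Rintegral_cst//= mul1r probability_setT/= lerD2l.
  set I := Rintegral _ _ _.
  have I0 : 0 <= I by apply: Rintegral_ge0 => x _; exact: powR_ge0.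
  have IS : ((I `^ t^-1)%:E <= S)%E.
    apply: ereal_sup_ubound; exists r => //.
    by rewrite Rintegral_EFin.
  have IM : I `^ t^-1 <= M.
    rewrite /M le_max; apply/orP; right; rewrite -lee_fin fineK//.
    rewrite ge0_fin_numE//; apply: le_trans IS; by rewrite lee_fin powR_ge0.
  rewrite -[leLHS](powRr1 I0) -(mulVf (lt0r_neq0 t0)) powRrM.
  apply: ge0_ler_powR; rewrite ?nnegrE ?powR_ge0 ?(ltW t0)//.
  exact: le_trans (powR_ge0 _ _) IM.
- move=> _ _ _; exists 1 => // r Rr.
  by rewrite Rintegral_cst//= mul1r probability_setT.
Qed.

Lemma YR_bounded Rs : Rs `<=` Pspace +oo -> moment_bounded +oo Rs ->
  exists2 M, 0 <= M & forall y, YR Rs y -> `|y| <= M.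
Proof.
rewrite /moment_bounded; set S := ereal_sup _ => Rss Sfin.
exists (Num.max 0 (fine S)) => [|y [r Rr ry]]; first by rewrite le_max lexx.
rewrite le_max; apply/orP; right; rewrite -lee_fin.
have yS : (`|y|%:E <= S)%E.
  apply: (@le_trans _ _ (moment +oo r)).
    by apply: ereal_sup_ubound; exists y.
  by apply: ereal_sup_ubound; exists r.
by rewrite fineK// ge0_fin_numE// (le_trans _ yS).
Qed.

End Growth.

(** * Tails of the product xy *)

Section Tail.
Context {R : realType}.
Implicit Types (m r : Pr R) (Rs : set (Pr R)).

Lemma continuous_scale (c : R) (f : R -> R) :
  continuous f -> continuous (fun x => c * f x).
Proof. by move=> cf x; apply: cvgM; [exact: cvg_cst|exact: cf]. Qed.

Lemma continuous_norm_powR (t : R) : 1 <= t ->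
  continuous (fun x : R => `|x| `^ t).
Proof.
move=> t1 x; have t0 : 0 < t by exact: lt_le_trans t1.
have [->|x0] := eqVneq x 0.
  rewrite /continuous_at normr0 powR0 ?gt_eqF//.
  apply/cvgr0Pnorm_le => e e0.
  apply: filterS2 (@nbhs0_le R R^o _ ltr01) (@nbhs0_le R R^o _ e0) => y y1 ye.
  rewrite ger0_norm ?powR_ge0//; apply: le_trans ye.
  have [->|y0] := eqVneq y 0; first by rewrite normr0 powR0 ?gt_eqF.
  rewrite -[leRHS](powRr1 (normr_ge0 _)); apply: ger_powR => //.
  by rewrite normr_gt0 y0.
have xE : \forall y \near x, expR (t * ln `|y|) = `|y| `^ t.
  have : \forall y \near x, y != 0.
    by apply: open_nbhs_nbhs; split => //; exact: open_neq.
  by apply: filterS => y y0; rewrite /powR normr_eq0 (negbTE y0).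
have lnx : {for x, continuous (fun y : R => ln `|y|)}.
  apply: (@continuous_comp _ _ _ (fun y : R => `|y|) (@ln R)).
    exact: norm_continuous.
  by apply: continuous_ln; rewrite normr_gt0.
have expx : {for x, continuous (fun y : R => expR (t * ln `|y|))}.
  apply: (@continuous_comp _ _ _ (fun y : R => t * ln `|y|) (@expR R)).
    by apply: cvgM => //; exact: cvg_cst.
  exact: continuous_expR.
rewrite /continuous_at {2}/powR normr_eq0 (negbTE x0).
exact: cvg_trans (near_eq_cvg xE) expx.
Qed.

(** The absolute value keeps the growth bounds valid on the whole line, where
    the second potentials have to be defined. *)
Definition excess (n : nat) (y : R) : R := Num.max 0 (`|y| - n%:R).

Lemma excess_ge0 n y : 0 <= excess n y.
Proof. by rewrite le_max lexx. Qed.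

Lemma excess_le n y : excess n y <= `|y|.
Proof. by rewrite ge_max normr_ge0/= gerBl. Qed.

Lemma continuous_excess n : continuous (excess n).
Proof.
move=> y; apply: (@continuous_max _ _ (cst 0) (fun y : R => `|y| - n%:R)).
  exact: cvg_cst.
by apply: cvgB; [exact: norm_continuous|exact: cvg_cst].
Qed.

Lemma excess_eventually0 y : exists N, forall n, (N <= n)%N -> excess n y = 0.
Proof.
exists (Num.bound `|y|) => n Nn; apply/max_idPl.
rewrite subr_le0; apply: (le_trans (ltW (archi_boundP (normr_ge0 y)))).
by rewrite ler_nat.
Qed.

Lemma continuous_excess_powR (t : R) n : 1 <= t ->
  continuous (fun y : R => excess n y `^ t).
Proof.
move=> t1; rewrite (_ : (fun _ => _) = (fun y => `|y| `^ t) \o excess n).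
  move=> y; apply: continuous_comp; first exact: continuous_excess.
  exact: continuous_norm_powR.
by apply/funext => y /=; rewrite ger0_norm// excess_ge0.
Qed.

Lemma excess_powR_le (t : R) n y : 1 <= t -> excess n y `^ t <= `|y| `^ t.
Proof.
move=> t1; apply: ge0_ler_powR; rewrite ?nnegrE ?excess_ge0 ?excess_le//.
exact: le_trans t1.
Qed.

Lemma excess_powR_small (t : R) m : 1 <= t -> Pspace t%:E m ->
  forall e, 0 < e -> exists n, \int[m]_x (excess n x `^ t) <= e.
Proof.
move=> t1 mt; apply: (@dominated_null _ _ _ m (fun n x => excess n x `^ t)
  (fun x => `|x : R| `^ t)).
- move=> n; apply: (@continuous_measurable_fun R).
  exact: continuous_excess_powR.
- exact: moment_integrable.
- move=> n x; rewrite ger0_norm ?powR_ge0//; exact: excess_powR_le.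
- move=> x; have [N xN] := excess_eventually0 x.
  exists N => n Nn; rewrite xN// powR0// gt_eqF//; exact: lt_le_trans t1.
Qed.

Lemma excess_small s m : (1 <= s)%E -> Pspace s m ->
  forall e, 0 < e -> exists n, \int[m]_x excess n x <= e.
Proof.
move=> s1 ms; apply: (@dominated_null _ _ _ m excess
  (fun x => `|x : R|)).
- move=> n; apply: (@continuous_measurable_fun R).
  exact: continuous_excess.
- exact: norm_integrable ms.
- move=> n x; rewrite ger0_norm ?excess_ge0//; exact: excess_le.
- exact: excess_eventually0.
Qed.

(** Young's inequality applied to [k * a] and [k^-1 * b], with [k ^ t = c]. *)
Lemma scaled_young (t s c : R) : 1 < t -> t^-1 + s^-1 = 1 -> 0 < s -> 0 < c ->
  exists2 C, 0 < C & forall a b, 0 <= a -> 0 <= b ->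
    a * b <= c * a `^ t + C * b `^ s.
Proof.
move=> t1 ts s0 c0; have t0 : 0 < t by exact: lt_trans t1.
pose k := c `^ t^-1.
have k0 : 0 < k by rewrite powR_gt0.
have kt : k `^ t = c by rewrite -powRrM mulVf ?gt_eqF// powRr1 ?ltW.
have tV : t^-1 <= 1 by rewrite invf_le1// ltW.
have sV : s^-1 <= 1 by rewrite -ts lerDr invr_ge0 ltW.
exists (k^-1 `^ s) => [|a b a0 b0]; first by rewrite powR_gt0 ?invr_gt0.
have -> : a * b = (k * a) * (k^-1 * b) by field; rewrite gt_eqF.
have ka : 0 <= k * a by apply: mulr_ge0 => //; exact: ltW.
have kb : 0 <= k^-1 * b by rewrite mulr_ge0// invr_ge0 ltW.
apply: le_trans (conjugate_powR ka kb t0 s0 ts) _.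
rewrite -kt -!powRM ?invr_ge0 ?(ltW k0)//.
by apply: lerD; rewrite ler_piMr ?powR_ge0.
Qed.

(** Truncating [y] at level [n] replaces [x * y] by [x * min n y]; the lemma
    bounds the difference by separate functions of [x] and [y] of small
    integral.  If [p = 1] then [YR Rs] is bounded and large [n] leave no
    difference.  If [p = +oo] then [x] is bounded on the support and the mean
    excess of [y] tends to 0.  Otherwise Young's inequality is used, with a
    small constant in front of the power of [x], and then [n] is chosen to
    absorb the large constant in front of the power of [y]. *)
Lemma tail_split (p q : \bar R) m Rs r e :
  (1 <= p)%E -> q = hoelder_conjugate p -> Pspace p m ->
  Rs `<=` Pspace q -> moment_bounded q Rs -> Rs r -> 0 < e ->
  exists n (h k : R -> R), [/\
    [/\ continuous h, continuous k, C0 p setT h & C0 q setT k],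
    \int[m]_x h x <= e, \int[r]_y k y <= e &
    forall x y, msupport m x -> YR Rs y -> `|x| * excess n y <= h x + k y].
Proof.
move=> p1 qp mp Rsq Rsb Rr e0.
have c0C0 s : C0 s setT (cst 0 : R -> R).
  by apply: (@growth_C0 _ _ _ _ 0); [exact: cst_continuous|
    move=> x _; rewrite normr0 mul0r].
have c0 : continuous (cst 0 : R -> R) by exact: cst_continuous.
case: p p1 qp mp => [t| |]//.
- rewrite lee_fin le_eqVlt => /predU1P[<-|t1] qp mp.
  + move: qp Rsq Rsb; rewrite hoelder_conjugate1 => ->.
    move=> Rsq /(YR_bounded Rsq)[M M0 YM].
    exists (Num.bound M), (cst 0), (cst 0); split => //.
    - by rewrite Rintegral_cst// mul0r ltW.
    - by rewrite Rintegral_cst// mul0r ltW.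
    - move=> x y _ /YM yM; rewrite /excess (max_idPl _) ?mulr0 ?addr0//.
      rewrite subr_le0 (le_trans yM)// ltW// archi_boundP//.
  + have t0 : 0 < t by exact: lt_trans t1.
    have t1' : 0 < t - 1 by rewrite subr_gt0.
    pose s := t / (t - 1).
    have s1 : 1 <= s by rewrite ler_pdivlMr// mul1r gerBl.
    have s0 : 0 < s by exact: lt_le_trans s1.
    have ts : t^-1 + s^-1 = 1 by rewrite /s; field; rewrite !gt_eqF.
    have qs : q = s%:E.
      by rewrite qp /hoelder_conjugate/= eqe gt_eqF// -EFinB inver gt_eqF.
    subst q; rewrite qs in Rsq Rsb *.
    have mt := moment_integrable (ltW t1) mp.
    set A := \int[m]_x (`|x| `^ t).
    have A0 : 0 <= A by apply: Rintegral_ge0 => x _; exact: powR_ge0.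
    have [c c_gt0 cA] : exists2 c : R, 0 < c & c * A <= e.
      have A1 : 0 < 1 + A by rewrite ltr_pwDl.
      exists (e / (1 + A)); first exact: divr_gt0.
      by rewrite mulrAC ler_pdivrMr// ler_pM2l// lerDr.
    have [C C_gt0 young] := scaled_young t1 ts s0 c_gt0.
    have [n rn] := excess_powR_small s1 (Rsq _ Rr) (divr_gt0 e0 C_gt0).
    have ch : continuous (fun x : R => c * `|x| `^ t).
      by apply: continuous_scale; exact: continuous_norm_powR (ltW t1).
    have ck : continuous (fun x : R => C * excess n x `^ s).
      by apply: continuous_scale; exact: continuous_excess_powR.
    exists n, (fun x => c * `|x| `^ t), (fun y => C * excess n y `^ s).
    split.
    - split => //.
      + apply: (@growth_C0 _ _ _ _ c).
          exact: continuous_subspaceT.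
        move=> x _; rewrite ger0_norm ?mulr_ge0 ?powR_ge0 ?(ltW c_gt0)//.
        by rewrite ler_pM2l//= lerDr.
      + apply: (@growth_C0 _ _ _ _ C); first exact: continuous_subspaceT.
        move=> x _; rewrite ger0_norm ?mulr_ge0 ?powR_ge0 ?(ltW C_gt0)//.
        by rewrite ler_pM2l//= ler_wpDl// excess_powR_le.
    - by rewrite RintegralZl.
    - rewrite RintegralZl//; last first.
        apply: (full_dominated_integrable measurableT _ _
          (moment_integrable s1 (Rsq _ Rr))).
        + by rewrite setCT measure0.
        + apply: (@continuous_measurable_fun R).
          exact: continuous_excess_powR.
        + move=> x _; rewrite ger0_norm ?powR_ge0//.
          exact: excess_powR_le.
      by rewrite -ler_pdivlMl// mulrC.
    - by move=> x y _ _; apply: young; rewrite ?excess_ge0.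
- rewrite hoelder_conjugatey => _ qp /moment_pinfty_bound[M M0 mM].
  subst q; pose c := e / (1 + M).
  have M1 : 0 < 1 + M by rewrite ltr_pwDl.
  have [n rn] := excess_small (lexx 1%E) (Rsq _ Rr) (divr_gt0 e0 M1).
  exists n, (cst 0), (fun y => M * excess n y); split.
  + split => //.
      by apply: continuous_scale; exact: continuous_excess.
    apply: (@growth_C0 _ _ _ _ M).
      apply: continuous_subspaceT; apply: continuous_scale.
      exact: continuous_excess.
    move=> y _; rewrite normrM !ger0_norm ?excess_ge0// ler_wpM2l//.
    exact: le_trans (excess_le _ _) (le_weight _ _ _).
  + by rewrite Rintegral_cst// mul0r ltW.
  + rewrite RintegralZl//; last first.
      apply: (full_dominated_integrable measurableT _ _
        (norm_integrable (lexx 1%E) (Rsq _ Rr))).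
      + by rewrite setCT measure0.
      + by apply: (@continuous_measurable_fun R); exact: continuous_excess.
      + by move=> y _; rewrite ger0_norm ?excess_ge0// excess_le.
    apply: (@le_trans _ _ (M * (e / (1 + M)))); first exact: ler_wpM2l.
    by rewrite mulrCA ler_piMr ?ltW// ltr_pdivrMr// mul1r ltrDr.
  + by move=> x y mx _; rewrite /= add0r ler_wpM2r ?excess_ge0 ?mM.
Qed.

End Tail.

(** * Potentials from a layer-cake decomposition of xy *)

Section Potentials.
Context {R : realType}.
Implicit Types (a : nat -> R) (d x y t L : R).

(** [ramp d t y] is the length of the part of the interval from [t] to [t + d]
    that lies below [y]. *)
Definition ramp d t y : R := Num.min d (Num.max 0 (y - t)).

(** Riemann sums of the integrals of [(x - a(t))_+] over [t] in [0, n d] and of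
    [a(t)] over [t] in [0, min(n d, y)]: [a i] is the value of the threshold
    function on the interval from [i d] to [(i + 1) d]. *)
Definition potx d n a x : R := \sum_(i < n) d * Num.max 0 (x - a i).
Definition poty d n a y : R := \sum_(i < n) a i * ramp d (i%:R * d) y.

Lemma ramp_itv d t y : 0 <= d -> 0 <= ramp d t y <= d.
Proof. by move=> d0; rewrite /ramp le_min d0 le_max lexx/= ge_min lexx. Qed.

Lemma sum_ramp d n y : 0 <= d -> 0 <= y ->
  \sum_(i < n) ramp d (i%:R * d) y = Num.min (n%:R * d) y.
Proof.
move=> d0 y0; elim: n => [|n IH]; first by rewrite big_ord0 mul0r min_l.
rewrite big_ord_recr/= IH /ramp -natr1 mulrDl mul1r.
set t := n%:R * d; rewrite /Num.max; case: (ltP 0 (y - t)) => yt.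
  rewrite (min_l (x := t)); last lra.
  by rewrite !minEle; case: leP => ?; case: leP => ?; lra.
rewrite (min_r (x := d))// (min_r (x := t)); last lra.
by rewrite min_r; lra.
Qed.

(** At most one interval of the grid contains [y] in its interior; its
    contribution is the cost of the discretization. *)
Lemma sum_partial_ramp d n y : 0 <= d ->
  \sum_(i < n) (if i%:R * d < y then d - ramp d (i%:R * d) y else 0) <= d.
Proof.
move=> d0; elim: n => [|n IH]; first by rewrite big_ord0.
rewrite big_ord_recr/=; case: ltP => [ny|_]; last by rewrite addr0.
rewrite big1 ?add0r => [|i _].
  by rewrite gerBl; have /andP[] := ramp_itv (n%:R * d) y d0.
have iy : i%:R * d + d <= y.
  apply: le_trans (ltW ny); rewrite -{2}(mul1r d) -mulrDl natr1 ler_wpM2r//.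
  by rewrite ler_nat ltn_ord.
case: ltP => // _; rewrite /ramp min_l ?subrr// le_max; apply/orP; right; lra.
Qed.

(** Termwise, [x <= (x - a)_+ + a] is used with weight [w] and [0 <= (x - a)_+]
    with weight [d - w], where [0 <= w <= d] is the value of the ramp. *)
Lemma pot_le d n a x y : 0 <= d -> 0 <= y ->
  x * Num.min (n%:R * d) y <= potx d n a x + poty d n a y.
Proof.
move=> d0 y0; rewrite -sum_ramp// mulr_sumr -big_split/=; apply: ler_sum => i _.
have /andP[] := ramp_itv (i%:R * d) y d0; set w := ramp _ _ _ => w0 wd.
set e := Num.max 0 _; have e0 : 0 <= e by rewrite le_max lexx.
have xe : x - a i <= e by rewrite le_max lexx orbT.
have := ler_wpM2l w0 xe; have := ler_wpM2r e0 wd; lra.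
Qed.

Section Comonotone.
Variables (D : set R) (X Y : R -> R).
Hypothesis Xmono : forall u v, D u -> D v -> u <= v -> X u <= X v.
Hypothesis Ymono : forall u v, D u -> D v -> u <= v -> Y u <= Y v.

(** The threshold at level [t] is the supremum of [X] over the parameters with
    [Y u <= t], clamped between [- L] and [L].  It is below [X u] when
    [t < Y u], since such a [u] is to the right of all these parameters. *)
Lemma comonotone_threshold L t : 0 <= L -> exists a : R, [/\ `|a| <= L,
  forall u, D u -> Y u <= t -> Num.min (X u) L <= a &
  forall u, D u -> t < Y u -> a <= Num.max (X u) (- L)].
Proof.
move=> L0; pose clamp v := Num.max (- L) (Num.min v L).
pose A := [set - L] `|` [set clamp (X u) | u in [set u | D u /\ Y u <= t]].
have ubA : ubound A L.
  by move=> _ [->|[u _ <-]]; rewrite ?ge_max ?ge_min ?lexx ?orbT ?andbT; lra.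
have supA : has_sup A by split; [exists (- L); left|exists L].
have leA v : A v -> v <= sup A by move=> Av; apply: ub_le_sup => //; exists L.
exists (sup A); split.
- rewrite ler_norml leA ?ge_sup//; first by exists (- L); left.
  by left.
- move=> u Du Yu; apply: (@le_trans _ _ (clamp (X u))).
    by rewrite le_max lexx orbT.
  by apply: leA; right; exists u.
- move=> u Du Yu; apply: ge_sup; first by exists (- L); left.
  move=> _ [->|[v [Dv Yv] <-]]; first by rewrite le_max lexx orbT.
  have vu : v <= u.
    by rewrite leNgt; apply/negP => /ltW uv; have := Ymono Du Dv uv; lra.
  have := Xmono Dv Du vu; rewrite /clamp ge_max !le_max lexx orbT/=.
  by move=> Xvu; rewrite ge_min Xvu.
Qed.

(** Along the curve [u |-> (X u, Y u)], the inequality of [pot_le] is nearly an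
    equality.  The term with [n%:R * d] is the price of clamping the thresholds
    at [L], the term with [d] that of the grid. *)
Lemma comonotone_pot L d n : 0 <= L -> 0 <= d -> exists a : nat -> R,
  (forall i, `|a i| <= L) /\
  forall u, D u -> 0 <= Y u ->
    potx d n a (X u) + poty d n a (Y u) <= X u * Num.min (n%:R * d) (Y u) +
      n%:R * d * Num.max 0 (`|X u| - L) + d * (`|X u| + L).
Proof.
move=> L0 d0.
have /choice[a aP] := fun i : nat => comonotone_threshold (i%:R * d) L0.
exists a; split => [i|u Du Yu0]; first by have [] := aP i.
rewrite -[Num.min _ (Y u)]sum_ramp// mulr_sumr.
set x := X u; set e := Num.max 0 _.
have e0 : 0 <= e by rewrite le_max lexx.
have eL : `|x| - L <= e by rewrite le_max lexx orbT.
have -> : n%:R * d * e = \sum_(i < n) d * e.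
  by rewrite sumr_const card_ord -[RHS]mulr_natl mulrA.
apply: le_trans (lerD (lexx _) (ler_wpM2r _ (sum_partial_ramp n (Y u) d0))).
  rewrite mulr_suml -!big_split/=; apply: ler_sum => i _.
  have [aL lea gea] := aP i.
  have /andP[] := ramp_itv (i%:R * d) (Y u) d0; set w := ramp _ _ _ => w0 wd.
  have := ler_norm x; have := ler_norm (- x); rewrite normrN => xN xP.
  move: aL; rewrite ler_norml => /andP[aN aL].
  set z := Num.max 0 (x - a i).
  have z0 : 0 <= z by rewrite le_max lexx.
  have zE : z = 0 \/ z = x - a i.
    by rewrite /z maxEle; case: ifP; [right|left].
  case: ltP => [/(gea u Du) ax|Yt].
    (* [Y u] is above the left end of the interval, and the threshold is below
       the clamped [x]; the ramp may be partial *)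
    have axe : a i - x <= e.
      by move: ax; rewrite le_max -/x => /orP[] ax; lra.
    have zL : z <= `|x| + L by rewrite ge_max; apply/andP; split; lra.
    have dw0 : 0 <= d - w by lra.
    have wax := ler_wpM2l w0 axe; have we := ler_wpM2r e0 wd.
    have dwz := ler_wpM2l dw0 zL; have dwz0 := mulr_ge0 dw0 z0.
    have de := mulr_ge0 d0 e0.
    by move: dwz dwz0; case: zE => -> dwz dwz0; lra.
  (* [Y u] is below the interval, and the threshold is above the clamped [x] *)
  have -> : w = 0 by rewrite /w /ramp (max_idPl _) ?subr_le0// min_r.
  have ze : z <= e.
    have := lea u Du Yt; rewrite ge_min -/x => /orP[] xa; case: zE => ->; lra.
  by have := ler_wpM2l d0 ze; lra.
by rewrite addr_ge0.
Qed.

End Comonotone.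

Lemma continuous_sum n (F : nat -> R -> R) : (forall i, continuous (F i)) ->
  continuous (fun x => \sum_(i < n) F i x).
Proof.
move=> cF; elim: n => [|n IH].
  under eq_fun do rewrite big_ord0; exact: cst_continuous.
under eq_fun do rewrite big_ord_recr/=.
by move=> x; apply: cvgD; [exact: IH|exact: cF].
Qed.

Lemma continuous_potx d n a : continuous (potx d n a).
Proof.
apply: (continuous_sum (F := fun i x => d * Num.max 0 (x - a i))) => i x.
apply: cvgM; first exact: cvg_cst.
apply: (@continuous_max _ _ (cst 0) (fun x : R => x - a i)).
  exact: cvg_cst.
by apply: cvgB; [exact: cvg_id|exact: cvg_cst].
Qed.

Lemma continuous_poty d n a : continuous (poty d n a).
Proof.
apply: (continuous_sum (F := fun i y => a i * ramp d (i%:R * d) y)) => i x.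
apply: cvgM; first exact: cvg_cst.
apply: (@continuous_min _ _ (cst d) (fun x : R => Num.max 0 (x - i%:R * d))).
  exact: cvg_cst.
apply: (@continuous_max _ _ (cst 0) (fun x : R => x - i%:R * d)).
  exact: cvg_cst.
by apply: cvgB; [exact: cvg_id|exact: cvg_cst].
Qed.

Lemma potx_growth d n a L x : 0 <= d -> (forall i, `|a i| <= L) ->
  `|potx d n a x| <= n%:R * d * (`|x| + L).
Proof.
move=> d0 aL; apply: le_trans (ler_norm_sum _ _ _) _.
rewrite -mulrA [leRHS]mulr_natl -[n in leRHS]card_ord -sumr_const.
apply: ler_sum => i _; rewrite normrM (ger0_norm d0) ler_wpM2l//.
rewrite ger0_norm ?le_max ?lexx// ge_max.
have := aL i; have := ler_norm x; have := ler_norm (- a i); rewrite normrN.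
have := normr_ge0 x; have := normr_ge0 (a i); lra.
Qed.

Lemma poty_growth d n a L y : 0 <= d -> (forall i, `|a i| <= L) ->
  `|poty d n a y| <= n%:R * d * L.
Proof.
move=> d0 aL; apply: le_trans (ler_norm_sum _ _ _) _.
rewrite -mulrA [leRHS]mulr_natl -[n in leRHS]card_ord -sumr_const.
apply: ler_sum => i _; rewrite normrM mulrC.
have /andP[w0 wd] := ramp_itv (i%:R * d) y d0.
by apply: ler_pM => //; rewrite ger0_norm.
Qed.

End Potentials.

(** * Quantile functions and the monotone coupling *)

Section Quantile.
Context {R : realType}.
Variable m : Pr R.

Let idR : measurableTypeR R -> R := idfun.

#[local] HB.instance Definition _ :=
  @isMeasurableFun.Build _ _ _ _ idR (@measurable_id _ _ setT).

Definition distrib (x : R) : R := fine (m `]-oo, x]%classic).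

Lemma distribE x : (distrib x)%:E = m `]-oo, x]%classic.
Proof. by rewrite fineK// fin_num_measure. Qed.

Let cdfE : cdf (idR : {RV m >-> R}) = fun x => (distrib x)%:E.
Proof.
apply/funext => x.
by rewrite distribE /cdf /distribution /pushforward preimage_id.
Qed.

Lemma distrib_mono : {homo distrib : x y / x <= y}.
Proof.
move=> x y xy; rewrite -lee_fin.
by have := @cdf_nondecreasing _ _ _ m (idR : {RV m >-> R}) _ _ xy; rewrite cdfE.
Qed.

Lemma distrib_itv x : 0 <= distrib x <= 1.
Proof. by rewrite -!lee_fin distribE measure_ge0 probability_le1. Qed.

Lemma distrib_gt u : u < 1 -> exists x, u <= distrib x.
Proof.
move=> u1; have := @cvg_cdfy1 _ _ _ m (idR : {RV m >-> R}); rewrite cdfE.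
move=> /fine_cvgP[_] /cvgrPdist_lt/(_ (1 - u)); rewrite subr_gt0 => /(_ u1).
move=> [M [_ Mx]]; exists (M + 1).
have := Mx (M + 1) (ltac:(by rewrite ltrDl)) => /=.
by rewrite ltr_norml => /andP[_]; lra.
Qed.

Lemma distrib_lt u : 0 < u -> exists x, distrib x < u.
Proof.
move=> u0; have := @cvg_cdfNy0 _ _ _ m (idR : {RV m >-> R}); rewrite cdfE.
move=> /fine_cvgP[_] /cvgrPdist_lt/(_ u u0).
move=> [M [_ Mx]]; exists (M - 1).
have := Mx (M - 1) (ltac:(by rewrite gtrBl)) => /=.
by rewrite ltr_norml => /andP[+ _]; lra.
Qed.

(** Right continuity, in the form needed to see that the infimum defining
    [quantile] is attained. *)
Lemma distrib_right_lt x u : distrib x < u -> exists2 y, x < y & distrib y < u.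
Proof.
move=> xu; have := @cdf_right_continuous _ _ _ m (idR : {RV m >-> R}) x.
rewrite cdfE => /fine_cvgP[_] /cvgrPdist_lt/(_ (u - distrib x)).
rewrite subr_gt0 => /(_ xu) [e /= e0 xe]; exists (x + e / 2); first by lra.
have xe2 : x < x + e / 2 by lra.
have xeb : ball_ [eta Num.Def.normr] x e (x + e / 2).
  by rewrite /= ltr_distlC; apply/andP; split; lra.
by have := xe _ xeb xe2; rewrite ltr_norml => /andP[+ _]; lra.
Qed.

Definition quantile (u : R) : R := inf [set x | u <= distrib x].

(** Quantile and distribution function form a Galois connection. *)
Lemma quantile_le u x : 0 < u < 1 -> (quantile u <= x) = (u <= distrib x).
Proof.
move=> /andP[u0 u1]; have [x0 ux0] := distrib_gt u1.
have [y0 y0u] := distrib_lt u0.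
have lbS : lbound [set x | u <= distrib x] y0.
  move=> x' /= ux'; rewrite leNgt; apply/negP => /ltW /distrib_mono; lra.
have infS : has_inf [set x | u <= distrib x] by split; [exists x0|exists y0].
apply/idP/idP => [qx|ux]; last by apply: ge_inf => //; exists y0.
rewrite leNgt; apply/negP => /distrib_right_lt[y xy yu].
have : quantile u < y by exact: le_lt_trans xy.
move=> /(inf_lt infS.1) [z /= uz zy].
by have := distrib_mono (ltW zy); lra.
Qed.

Lemma quantile_mono u v : 0 < u < 1 -> 0 < v < 1 -> u <= v ->
  quantile u <= quantile v.
Proof.
move=> u01 v01 uv; rewrite quantile_le// (le_trans uv)//.
by rewrite -quantile_le.
Qed.

Let D : set R := `]0, 1[%classic.

Lemma measurable_quantile :
  measurable_fun [set: measurableTypeR R] (quantile \_ D).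
Proof.
apply/(measurable_restrictT (quantile : measurableTypeR R -> R)
  (measurable_itv _)).
apply: (measurability _ (RGenOInfty.measurableE R)).
move=> _ [_ [x ->] <-].
rewrite (_ : _ `&` _ = D `&` `]distrib x, +oo[%classic).
  by apply: measurableI; exact: measurable_itv.
apply/seteqP; split => u /=; rewrite !in_itv/= !andbT => -[u01]; split => //.
  by rewrite ltNge -quantile_le// -ltNge.
by rewrite ltNge quantile_le// -ltNge.
Qed.

End Quantile.

Section Uniform.
Context {R : realType}.

Definition U01 : Pr R := uniform_prob (@ltr01 R).

Lemma U01E (A : set (measurableTypeR R)) : measurable A ->
  U01 A = lebesgue_measure (A `&` `[0, 1]%classic).
Proof.
move=> mA; rewrite /U01/= /uniform_prob integral_uniform_pdf.
rewrite (eq_integral (cst 1%E)) => [|x]; last first.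
  rewrite inE => -[_ /=]; rewrite in_itv/= /uniform_pdf => ->.
  by rewrite subr0 invr1.
by rewrite integral_cst ?mul1e//; exact: measurableI.
Qed.

Lemma U01_full : U01 (~` `]0, 1[%classic) = 0%E.
Proof.
rewrite probability_setC; last exact: measurable_itv.
rewrite U01E; last exact: measurable_itv.
rewrite setIidl; last by move=> x /=; rewrite !in_itv/= => /andP[/ltW-> /ltW->].
by rewrite lebesgue_measure_itv/= lte_fin ltr01 oppr0 adde0 subee.
Qed.

Lemma full_measureI d (T : measurableType d) (P : probability T R)
    (D A : set T) :
  measurable D -> measurable A -> P (~` D) = 0%E -> P A = P (A `&` D).
Proof.
move=> mD mA PD; rewrite (measureDI P mA mD).
rewrite [X in (X + _)%E](_ : _ = 0%E) ?add0e//.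
apply/eqP; rewrite eq_le measure_ge0 andbT -PD; apply: le_measure.
- by rewrite inE; exact: measurableD.
- by rewrite inE; exact: measurableC.
- by move=> x [].
Qed.

(** The quantile function is only meaningful on the open unit interval: at the
    ends the set in its definition may be empty or unbounded below. *)
Definition quantile01 (m : Pr R) : measurableTypeR R -> measurableTypeR R :=
  quantile m \_ `]0, 1[%classic.

HB.instance Definition _ (m : Pr R) :=
  @isMeasurableFun.Build _ _ _ _ (quantile01 m) (measurable_quantile m).

(** By the Galois connection, the preimage of the interval from [a] to [b] is
    the interval from [distrib m a] to [distrib m b], up to a null set. *)
Lemma quantile_law (m : Pr R) (A : set (measurableTypeR R)) : measurable A ->
  U01 (quantile01 m @^-1` A) = m A.
Proof.
move=> mA; rewrite -[LHS]/(distribution U01 (quantile01 m) A).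
apply: (@measure_unique _ R (measurableTypeR R) (@ocitv R)
  (fun n => `](- n%:R), n%:R]%classic) erefl _ _ _
  (distribution U01 (quantile01 m)) m) => //.
- exact: ocitvI.
- by move=> n; exact: is_ocitv.
- exact: bigcup_itvT.
- move=> _ /ocitvP[->|[[a b]/= ab ->]]; first by rewrite !measure0.
  rewrite /distribution /pushforward.
  have mitv (i : interval R) : measurable ([set` i] : set (measurableTypeR R)).
    exact: measurable_itv.
  have mpre : measurable (quantile01 m @^-1` `]a, b]%classic).
    rewrite -[X in measurable X]setTI.
    exact: (measurable_quantile m measurableT (mitv _)).
  rewrite (full_measureI (mitv `]0, 1[) mpre U01_full).
  have -> : quantile01 m @^-1` `]a, b]%classic `&` `]0, 1[%classic =
      `]distrib m a, distrib m b]%classic `&` `]0, 1[%classic.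
    have qE u : 0 < u < 1 ->
        (a < quantile m u <= b) = (distrib m a < u <= distrib m b).
      by move=> u01; rewrite quantile_le// !ltNge quantile_le.
    apply/seteqP; split => u [+ u01]; rewrite /= /quantile01 patchE mem_set//;
      move: u01; rewrite /= !in_itv/= => u01; rewrite qE//.
  rewrite -(full_measureI (mitv `]0, 1[) (mitv _) U01_full) U01E//.
  have /andP[a0 _] := distrib_itv m a; have /andP[_ b1] := distrib_itv m b.
  rewrite setIidl; last first.
    move=> u /=; rewrite !in_itv/= => /andP[au ub].
    by rewrite (le_trans a0 (ltW au)) (le_trans ub b1).
  rewrite lebesgue_measure_itv/= lte_fin.
  have -> : `]a, b]%classic = `]-oo, b] `\` `]-oo, a].
    by rewrite -[RHS]setCK setCD setCitvl setUC -[LHS]setCK setCitv.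
  rewrite measureD//; last by rewrite ltey_eq fin_num_measure.
  rewrite setIidr; last by apply: subset_itvl; rewrite bnd_simp ltW.
  transitivity ((distrib m b)%:E - (distrib m a)%:E)%E; last first.
    by rewrite !distribE.
  rewrite -EFinB; case: ltP => // ba.
  congr EFin; apply/eqP; rewrite eq_sym subr_eq0 eq_le ba/=.
  exact: distrib_mono (ltW ab).
- by move=> k; rewrite ltey_eq fin_num_measure//; exact: measurable_itv.
Qed.

Definition quantile_pair (m r : Pr R) (u : measurableTypeR R) :
  measurableTypeR R * measurableTypeR R := (quantile01 m u, quantile01 r u).

Lemma measurable_quantile_pair m r : measurable_fun setT (quantile_pair m r).
Proof. by apply: measurable_fun_pair; exact: measurable_quantile. Qed.

HB.instance Definition _ (m r : Pr R) :=
  @isMeasurableFun.Build _ _ _ _ (quantile_pair m r)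
    (measurable_quantile_pair m r).

Definition quantile_coupling (m r : Pr R) : Pr2 R :=
  distribution U01 (quantile_pair m r).

Lemma quantile_coupling_fst m r (A : set (measurableTypeR R)) : measurable A ->
  quantile_coupling m r (A `*` setT) = m A.
Proof.
move=> mA; rewrite -quantile_law// /quantile_coupling/= /distribution/=.
by congr (U01 _); apply/seteqP; split => [u []|u Au].
Qed.

Lemma quantile_coupling_snd m r (B : set (measurableTypeR R)) : measurable B ->
  quantile_coupling m r (setT `*` B) = r B.
Proof.
move=> mB; rewrite -quantile_law// /quantile_coupling/= /distribution/=.
by congr (U01 _); apply/seteqP; split => [u []|u Bu].
Qed.

Lemma quantile01_mono (m : Pr R) u v : 0 < u < 1 -> 0 < v < 1 -> u <= v ->
  quantile01 m u <= quantile01 m v.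
Proof.
move=> u01 v01 uv; rewrite /quantile01 !patchE.
by rewrite !mem_set ?quantile_mono//= in_itv.
Qed.

End Uniform.

(** * A minimax theorem for finitely many affine functions *)

Section Minimax.
Context {R : realType} {T : Type}.
Implicit Types (D : set T) (Fam : set (T -> R)) (phi psi : T -> R) (c : R).

Definition affine_on D Fam := forall x y (t : R), D x -> D y -> 0 <= t <= 1 ->
  exists2 z, D z & forall phi, Fam phi -> phi z = (1 - t) * phi x + t * phi y.

Definition convex_family Fam := forall phi psi (t : R),
  Fam phi -> Fam psi -> 0 <= t <= 1 ->
  Fam (fun x => (1 - t) * phi x + t * psi x).

(** If the conclusion fails, the image of [D] under [(phi - c, psi - c)]
    misses the open positive quadrant. By convexity, it lies on one side
    of a line through the origin: the slope [mu] is the supremum of the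
    ratios of the points with [c < phi], and [cross] compares these points
    with those with [c < psi]. With normalized coefficients, its equation
    is a convex combination of [phi] and [psi] that never exceeds [c]. *)
Lemma minimax_two D Fam phi psi c : affine_on D Fam -> Fam phi -> Fam psi ->
  (forall t, 0 <= t <= 1 ->
    exists2 x, D x & c < (1 - t) * phi x + t * psi x) ->
  exists x, [/\ D x, c < phi x & c < psi x].
Proof.
move=> aff Fphi Fpsi cmix; apply: contrapT => noboth.
have neg x : D x -> c < phi x -> psi x <= c.
  by move=> Dx px; rewrite leNgt; apply/negP => qx; apply: noboth; exists x.
have [y0 Dy0] : exists2 y, D y & c < psi y.
  have [y Dy +] := cmix 1 (ltac:(by rewrite ler01 lexx)).
  by rewrite subrr mul0r add0r mul1r; exists y.
move=> y0c.
have cross x y : D x -> D y -> c < phi x -> c < psi y ->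
    (phi x - c) * (psi y - c) <= (c - phi y) * (c - psi x).
  move=> Dx Dy px qy; rewrite leNgt; apply/negP => lt.
  have qx := neg _ Dx px.
  have py : phi y <= c.
    by rewrite leNgt; apply/negP => py; apply: noboth; exists y.
  pose a := phi x - c; pose b := psi y - c.
  pose a' := c - phi y; pose b' := c - psi x.
  have a0 : 0 < a by rewrite subr_gt0.
  have b0 : 0 < b by rewrite subr_gt0.
  have a'0 : 0 <= a' by rewrite subr_ge0.
  have b'0 : 0 <= b' by rewrite subr_ge0.
  have aa0 : 0 < a + a' by rewrite ltr_wpDr.
  have bb0 : 0 < b + b' by rewrite ltr_wpDr.
  have lt' : a' * b' < a * b by [].
  (* on the segment from [x] to [y], [psi] exceeds [c] after [s0] and [phi]
     exceeds [c] before [s1] *)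
  pose s0 := b' / (b + b'); pose s1 := a / (a + a').
  have s00 : 0 <= s0 by rewrite divr_ge0// ltW.
  have s11 : s1 <= 1 by rewrite ler_pdivrMr// mul1r lerDl.
  have s0s1 : s0 < s1 by rewrite ltr_pdivrMr// mulrAC ltr_pdivlMr//; lra.
  pose s := (s0 + s1) / 2.
  have sa : s * (a + a') < a by rewrite -ltr_pdivlMr// -/s1 /s; lra.
  have sb : b' < s * (b + b') by rewrite -ltr_pdivrMr// -/s0 /s; lra.
  have s01 : 0 <= s <= 1 by rewrite /s; apply/andP; split; lra.
  have [z Dz zE] := aff x y s Dx Dy s01.
  apply: noboth; exists z; rewrite !zE//.
  by split => //; move: sa sb; rewrite /a /a' /b /b'; lra.
pose A := [set v | exists x,
  [/\ D x, c < phi x & v = (phi x - c) / (c - psi x)]].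
have A_pos x : D x -> c < phi x -> 0 < c - psi x.
  move=> Dx px; have := cross x y0 Dx Dy0 px y0c.
  have := neg _ Dx px; rewrite le_eqVlt.
  move=> /predU1P[->|]; last by rewrite subr_gt0.
  by rewrite subrr mulr0 leNgt mulr_gt0// subr_gt0.
pose mu := sup ([set 0] `|` A).
have ubA y : D y -> c < psi y ->
    ubound ([set 0] `|` A) ((c - phi y) / (psi y - c)).
  move=> Dy qy v; have py : phi y <= c.
    by rewrite leNgt; apply/negP => py; apply: noboth; exists y.
  move=> [->|[x [Dx px ->]]]; first by rewrite divr_ge0 ?subr_ge0 ?(ltW qy).
  rewrite ler_pdivrMr ?A_pos// mulrAC ler_pdivlMr ?subr_gt0//.
  exact: cross.
have supA : has_sup ([set 0] `|` A).
  by split; [exists 0; left|exists ((c - phi y0) / (psi y0 - c)); exact: ubA].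
have mu0 : 0 <= mu by apply: ub_le_sup; [exact: supA.2|left].
have mixle x : D x -> phi x + mu * psi x <= (1 + mu) * c.
  move=> Dx; have [px|px] := ltP c (phi x).
    have : (phi x - c) / (c - psi x) <= mu.
      by apply: ub_le_sup; [exact: supA.2|right; exists x].
    by rewrite ler_pdivrMr ?A_pos//; lra.
  have [qx|qx] := ltP c (psi x).
    have : mu <= (c - phi x) / (psi x - c).
      by apply: ge_sup; [exact: supA.1|exact: ubA].
    by rewrite ler_pdivlMr ?subr_gt0//; lra.
  by have := ler_wpM2l mu0 qx; lra.
have mu1 : 0 < 1 + mu by rewrite ltr_pwDl.
have [] := cmix (mu / (1 + mu)).
  by rewrite divr_ge0 ?(ltW mu1)//= ler_pdivrMr// mul1r lerDr.
move=> x Dx; rewrite ltNge => /negP; apply.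
have -> : (1 - mu / (1 + mu)) * phi x + mu / (1 + mu) * psi x =
    (phi x + mu * psi x) / (1 + mu) by field; rewrite gt_eqF.
by rewrite ler_pdivrMr// [leRHS]mulrC mixle.
Qed.

(** The last function is handled by restricting [D] to the points where it
    exceeds [c]; [minimax_two] says that all other functions of the family still
    exceed [c] somewhere on this smaller convex set. *)
Lemma minimax_finite D Fam c :
  D !=set0 -> affine_on D Fam -> convex_family Fam ->
  (forall phi, Fam phi -> exists2 x, D x & c < phi x) ->
  forall n (phis : nat -> T -> R), (forall i, (i < n)%N -> Fam (phis i)) ->
  exists2 x, D x & forall i, (i < n)%N -> c < phis i x.
Proof.
move=> + + cvxF + n; elim: n D => [|n IH] D [x0 Dx0] aff Fc phis Fphis.
  by exists x0.
pose D' := [set x | D x /\ c < phis n x].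
have Fn : Fam (phis n) by exact: Fphis.
have D'0 : forall phi, Fam phi -> exists2 x, D' x & c < phi x.
  move=> phi Fphi.
  have [|x [Dx px nx]] := @minimax_two D Fam phi (phis n) c aff Fphi Fn.
    by move=> t t01; apply: Fc; exact: cvxF.
  by exists x.
have aff' : affine_on D' Fam.
  move=> x y t [Dx nx] [Dy ny] t01; have [z Dz zE] := aff x y t Dx Dy t01.
  exists z => //; split => //; rewrite zE//; move/andP: t01 => [t0 t1].
  have [t1'|] := ltP t 1; last first.
    by move=> t1'; rewrite (_ : t = 1)// ?subrr ?mul0r ?add0r ?mul1r//; lra.
  have : (1 - t) * c < (1 - t) * phis n x.
    by rewrite ltr_pM2l// subr_gt0.
  have := ler_wpM2l t0 (ltW ny); lra.
have [x D'x _] := D'0 _ Fn.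
have [y [Dy ny] yi] := IH D' (ex_intro _ x D'x) aff' D'0 phis
  (fun i ni => Fphis i (ltnW ni)).
by exists y => // i; rewrite ltnS leq_eqVlt => /predU1P[->|/yi].
Qed.

End Minimax.

(** * Weak-star limits of measures with bounded moments *)

Lemma fmap_ultra (T U : Type) (G : set_system T) (f : T -> U) :
  UltraFilter G -> UltraFilter (f @ G).
Proof.
move=> GU; apply: Build_UltraFilter => H HP GH.
rewrite predeqE => A; split=> [HA|]; last exact: GH.
have [//|GA] := in_ultra_setVsetC (f @^-1` A) GU.
have HCA : H (~` A) by exact: GH.
by have [x []] := filter_ex (filterI HA HCA).
Qed.

Section WeakStar.
Context {R : realType}.
Variables (q : \bar R) (Rs : set (Pr R)).
Hypotheses (q1 : (1 <= q)%E) (Rsq : Rs `<=` Pspace q).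
Hypotheses (Rsb : moment_bounded q Rs) (Rscl : weakstar_closed q Rs).

Lemma C0R_integrable (g : C0R q) r : Rs r ->
  r.-integrable setT (EFin \o g).
Proof.
move=> Rr; have /set_mem Cg := C0funP g; have [C _ gC] := C0_growth Cg.
apply: (growth_integrable q1 (Rsq Rr)) => [|x _]; last exact: gC.
apply: continuous_measurable_fun.
by have [/(iffRL (continuous_subspace_setT _))] := Cg.
Qed.

(** The functionals given by the measures of [Rs] lie in one ball of the
    dual. *)
Lemma C0R_integral_bound : exists2 B : R, 0 <= B &
  forall (g : C0R q) r, Rs r -> `|\int[r]_y g y| <= B * `|g|.
Proof.
have [B B0 RB] := uniform_weight_bound q1 Rsq Rsb.
exists B => // g r Rr; have gi := C0R_integrable g Rr.
have wi := weight_integrable q1 (Rsq Rr).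
apply: le_trans (le_normr_Rintegral measurableT gi) _.
apply: (@le_trans _ _ (\int[r]_y (`|g| * weight q y))).
  apply: le_Rintegral => //.
  - exact: integrable_norm gi.
  - by have /(integrableZl measurableT `|g|) := wi.
  - move=> y _; rewrite -ler_pdivrMr ?weight_gt0//.
    by rewrite -lee_fin [X in (_ <= X)%E]C0RnormE; exact: C0norm_ub.
by rewrite RintegralZl// mulrC ler_wpM2r// RB.
Qed.

Lemma bounded_dual (l : C0R q -> R^o) (B : R) : 0 <= B -> linear l ->
  (forall g, `|l g| <= B * `|g|) -> dual (C0R q) l.
Proof.
move=> B0 ll lB; split => // f; apply/(@cvgrPdist_le _ _ _ (nbhs f)) => e e0.
near=> g; have -> : l f - l g = l (f - g).
  by rewrite (_ : f - g = (-1) *: g + f) ?ll ?scaleN1r 1?addrC.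
apply: le_trans (lB _) _; apply: (@le_trans _ _ ((1 + B) * `|f - g|)).
  by rewrite ler_wpM2r// lerDr.
rewrite -ler_pdivlMl ?ltr_pwDl//; near: g.
by apply: cvgr_dist_le => //; rewrite mulr_gt0// invr_gt0 ltr_pwDl.
Unshelve. all: by end_near. Qed.

Lemma integral_linear r : Rs r ->
  linear ((fun g => \int[r]_y g y) : C0R q -> R^o).
Proof.
move=> Rr a g h; rewrite -[RHS]/(a * _ + _).
rewrite -RintegralZl//; last exact: C0R_integrable.
rewrite -RintegralD//; last exact: C0R_integrable.
have /(integrableZl measurableT a) := C0R_integrable g Rr; exact.
Qed.

Lemma integral_dual r : Rs r -> dual (C0R q) (fun g => \int[r]_y g y).
Proof.
move=> Rr; have [B B0 RB] := C0R_integral_bound.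
by apply: (bounded_dual B0) => [|g]; [exact: integral_linear|exact: RB].
Qed.

(** The argument of the Banach-Alaoglu theorem: the integrals of each test
    function stay in a compact interval, so they converge along [G]; the limits
    form a bounded linear functional, which is in the weak-star closure of
    [Rs]. *)
Lemma ultra_measure_limit (G : set_system (Pr R)) : UltraFilter G -> G Rs ->
  exists2 r, Rs r & forall g : C0R q,
    (fun r' : Pr R => \int[r']_y g y) @ G --> \int[r]_y g y.
Proof.
move=> GU GRs; have [B B0 RB] := C0R_integral_bound.
have /choice[l lP] : forall g : C0R q, exists a : R,
    (fun r' : Pr R => \int[r']_y g y) @ G --> a.
  move=> g; have := @segment_compact R (- (B * `|g|)) (B * `|g|).
  rewrite compact_ultra.
  move=> /(_ _ (fmap_ultra (fun r' : Pr R => \int[r']_y g y) GU)).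
  case=> [|a [_ aP]]; last by exists a.
  rewrite /fmap/=; apply: (@filterS _ G _ Rs) GRs => r Rr.
  have := RB g r Rr; rewrite ler_norml => gB.
  by rewrite /= in_itv.
have lb g : `|l g| <= B * `|g|.
  have := @closed_cvg _ _ G _ _ [set x : R | `|x| <= B * `|g|] _ _ (l g) (lP g).
  apply => //; last by apply: (@filterS _ G _ Rs) GRs => r Rr; exact: RB.
  by apply: (closed_comp (fun x _ => @norm_continuous _ _ x) (@closed_le _ _)).
have llin : linear (l : C0R q -> R^o).
  move=> a g h; apply: (cvg_unique _ (lP _)) => //.
  have : (fun r' : Pr R => a * \int[r']_y g y + \int[r']_y h y) @ G -->
      a * l g + l h.
    by apply: cvgD => //; apply: cvgM => //; exact: cvg_cst.
  apply: cvg_trans; apply: near_eq_cvg; apply: filterS GRs => r Rr.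
  exact/esym/integral_linear.
pose L : dual (C0R q) := SigSub (mem_set (bounded_dual B0 llin lb)).
have : closure (measure_functionals q Rs) L.
  move=> A; rewrite nbhsE => -[_ [[V oV <-] VL] VA].
  have GV : G [set r : Pr R | V (fun g => \int[r]_y g y)].
    have : {ptws, (fun (r : Pr R) (g : C0R q) => \int[r]_y g y : R^o) @ G -->
        (l : C0R q -> R^o)}.
      by apply/pointwise_cvgP.
    by apply; apply: open_nbhs_nbhs.
  have [r [Rr Vr]] := filter_ex (filterI GRs GV).
  exists (SigSub (mem_set (integral_dual Rr))); split; last exact: VA.
  by exists r => // g; rewrite Rintegral_EFin//; exact: C0R_integrable.
rewrite -(closure_id _).1// => -[r Rr rl]; exists r => // g.
have -> : \int[r]_y g y = l g.
  by apply: EFin_inj; rewrite -Rintegral_EFin ?rl//; exact: C0R_integrable.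
exact: lP.
Qed.

(** Finite intersection property of the sets [c <= phi]. *)
Lemma measure_FIP (Fam : set (Pr R -> R)) (c : R) :
  (forall phi, Fam phi -> exists a (g : C0R q),
     forall r, Rs r -> phi r = a + \int[r]_y g y) ->
  (forall n (phis : nat -> Pr R -> R), (forall i, (i < n)%N -> Fam (phis i)) ->
     exists2 r, Rs r & forall i, (i < n)%N -> c < phis i r) ->
  exists2 r, Rs r & forall phi, Fam phi -> c <= phi r.
Proof.
move=> FamE FIP.
pose B (s : nat * (nat -> Pr R -> R)) : set (Pr R) :=
  [set r | Rs r /\ forall i, (i < s.1)%N -> c < s.2 i r].
pose S : set (nat * (nat -> Pr R -> R)) :=
  [set s | forall i, (i < s.1)%N -> Fam (s.2 i)].
have PF : ProperFilter (filter_from S B).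
  apply: filter_from_proper; last first.
    by move=> [n phis] /= /FIP[r Rr ri]; exists r.
  apply: filter_from_filter; first by exists (0%N, fun _ _ => 0).
  move=> [n phis] [k psis] Sn Sk.
  exists ((n + k)%N, fun i => if (i < n)%N then phis i else psis (i - n)%N).
    move=> i /= ink; case: ifP => [/Sn//|/negbT]; rewrite -leqNgt => ni.
    by apply: Sk; rewrite /= ltn_subLR.
  move=> r [Rr ri] /=; split; split => // i ii.
    by have := ri i; rewrite /= ii; apply; exact: ltn_addr.
  have niF : (n + i < n)%N = false by rewrite ltnNge leq_addr.
  by have := ri (n + i)%N; rewrite /= ltn_add2l niF addKn; exact.
have [G [GU FG]] := ultraFilterLemma PF.
have GB s : S s -> G (B s) by move=> Ss; apply: FG; exists s.
have GRs : G Rs.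
  have : G (B (0%N, fun _ _ => 0)) by exact: GB.
  by apply: filterS => r [].
have [r Rr rG] := ultra_measure_limit GU GRs.
exists r => // phi Fphi; have [a [g phiE]] := FamE _ Fphi.
have phiG : phi @ G --> phi r.
  have : (fun r' : Pr R => a + \int[r']_y g y) @ G --> phi r.
    by rewrite phiE//; apply: cvgD; [exact: cvg_cst|exact: rG].
  apply: cvg_trans; apply: near_eq_cvg.
  by apply: (@filterS _ G _ Rs) GRs => r' Rr'; rewrite phiE.
apply: (@closed_cvg _ _ G _ phi [set x : R | c <= x] _ _ (phi r) phiG).
  exact: closed_ge.
have : G (B (1%N, fun _ => phi)) by apply: GB.
by apply: filterS => r' [_ /(_ 0%N isT)/= /ltW].
Qed.

End WeakStar.

(** * Nearly optimal potentials for a single marginal *)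

Lemma integrable_scale d (T : measurableType d) (R : realType)
    (P : probability T R) (c : R) (f : T -> R) :
  P.-integrable setT (EFin \o f) ->
  P.-integrable setT (EFin \o (fun x => c * f x)).
Proof. by move=> /(integrableZl measurableT c). Qed.

Lemma integrable_add d (T : measurableType d) (R : realType)
    (P : probability T R) (f g : T -> R) :
  P.-integrable setT (EFin \o f) -> P.-integrable setT (EFin \o g) ->
  P.-integrable setT (EFin \o (fun x => f x + g x)).
Proof. by move=> fi /(integrableD measurableT fi). Qed.

Section Potentials.
Context {R : realType}.
Implicit Types (m r : Pr R) (Rs : set (Pr R)) (pi : Pr2 R).

Lemma C0_integrable s m (f : R -> R) : (1 <= s)%E -> Pspace s m ->
  continuous f -> C0 s (msupport m) f -> m.-integrable setT (EFin \o f).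
Proof.
move=> s1 ms cf Cf; have [C _ fC] := C0_growth Cf.
by apply: (growth_integrable s1 ms _ fC); exact: continuous_measurable_fun.
Qed.

Lemma C0_sub s (A B : set R) f :
  continuous f -> A `<=` B -> C0 s B f -> C0 s A f.
Proof.
move=> cf AB Cf; have [C _ fC] := C0_growth Cf.
by apply: (@growth_C0 _ _ _ _ C); [exact: continuous_subspaceT|move=> x /AB/fC].
Qed.

Lemma C0D s (A : set R) f g : continuous f -> continuous g ->
  C0 s A f -> C0 s A g -> C0 s A (fun x => f x + g x).
Proof.
move=> cf cg Cf Cg; have [C _ fC] := C0_growth Cf.
have [C' _ gC] := C0_growth Cg; apply: (@growth_C0 _ _ _ _ (C + C')).
  by apply: continuous_subspaceT => x; apply: cvgD; [exact: cf|exact: cg].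
move=> x Ax; rewrite (le_trans (ler_normD _ _))// mulrDl.
by rewrite lerD ?fC ?gC.
Qed.

Lemma C0Z s (A : set R) (c : R) f : continuous f ->
  C0 s A f -> C0 s A (fun x => c * f x).
Proof.
move=> cf Cf; have [C _ fC] := C0_growth Cf.
apply: (@growth_C0 _ _ _ _ (`|c| * C)).
  by apply: continuous_subspaceT; exact: continuous_scale.
by move=> x Ax; rewrite normrM -mulrA ler_wpM2l// fC.
Qed.

Lemma weight_ge1 (s : \bar R) x : 1 <= weight s x.
Proof. by case: s => [t| |] //=; rewrite lerDl powR_ge0. Qed.

Lemma excessE n (y : R) : 0 <= y -> y = Num.min n%:R y + excess n y.
Proof.
move=> y0; rewrite /excess ger0_norm// /Num.max subr_gt0 /Num.min.
by case: (ltgtP n%:R y) => yn; lra.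
Qed.

Section Coupling.
Variables (m r : Pr R) (pi : Pr2 R).
Hypothesis pi1 : forall A : set (measurableTypeR R), measurable A ->
  pi (A `*` setT) = m A.
Hypothesis pi2 : forall B : set (measurableTypeR R), measurable B ->
  pi (setT `*` B) = r B.

Lemma coupling_law1 (A : set (measurableTypeR R)) : measurable A ->
  pi (fst @^-1` A) = m A.
Proof.
move=> mA; rewrite -pi1//; congr (pi _).
by apply/seteqP; split => [z Az|z []].
Qed.

Lemma coupling_law2 (B : set (measurableTypeR R)) : measurable B ->
  pi (snd @^-1` B) = r B.
Proof.
move=> mB; rewrite -pi2//; congr (pi _).
by apply/seteqP; split => [z Bz|z []].
Qed.

Lemma coupling_msupport :
  pi (~` (msupport m `*` msupport r)) = 0%E.
Proof.
apply/eqP; rewrite eq_le measure_ge0 andbT.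
have mX := measurableC (measurable_msupport m).
have mY := measurableC (measurable_msupport r).
rewrite (_ : ~` _ =
  fst @^-1` (~` msupport m) `|` snd @^-1` (~` msupport r)); last first.
  apply/seteqP; split=> [z|z [zm [/zm]|zm []]//].
  by move=> /not_andP.
have mX' : measurable (fst @^-1` (~` msupport m) :
    set (measurableTypeR R * measurableTypeR R)).
  by rewrite -[X in measurable X]setTI; exact: measurable_fst.
have mY' : measurable (snd @^-1` (~` msupport r) :
    set (measurableTypeR R * measurableTypeR R)).
  by rewrite -[X in measurable X]setTI; exact: measurable_snd.
have := measureU2 pi mX' mY'.
have pX := etrans (coupling_law1 mX) (msupport_full m).
have pY := etrans (coupling_law2 mY) (msupport_full r).
move=> /le_trans; apply; rewrite le_eqVlt; apply/orP; left; apply/eqP.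
exact: etrans (congr2 adde pX pY) (adde0 0%E).
Qed.

End Coupling.

Section Problem.
Variables (p q : \bar R) (m : Pr R) (Rs : set (Pr R)).
Hypotheses (p1 : (1 <= p)%E) (qp : q = hoelder_conjugate p) (mp : Pspace p m).
Hypotheses (Rsq : Rs `<=` Pspace_pos q) (Rsb : moment_bounded q Rs).

Let q1 : (1 <= q)%E.
Proof. by rewrite qp hoelder_conj_ge1. Qed.

Let Rsq' : Rs `<=` Pspace q.
Proof. by move=> r /Rsq[]. Qed.

Lemma YR_ge0 y : YR Rs y -> 0 <= y.
Proof. by move=> [r Rr ry]; have [_ /(_ _ ry)] := Rsq Rr. Qed.

(** A by-product of [tail_split]: on the supports, [|x * y|] is at most
    [n%:R * |x| + h x + k y]. *)
Lemma product_integrable r pi : Rs r ->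
  (forall A : set (measurableTypeR R), measurable A -> pi (A `*` setT) = m A) ->
  (forall B : set (measurableTypeR R), measurable B -> pi (setT `*` B) = r B) ->
  pi.-integrable setT (fun z => ((z.1 : R) * (z.2 : R))%:E).
Proof.
move=> Rr pi1 pi2.
have [n [h [k [[ch ck Ch Ck] _ _ hk]]]] :=
  tail_split p1 qp mp Rsq' Rsb Rr ltr01.
have hi := C0_integrable p1 mp ch (C0_sub ch (@subsetT _ _) Ch).
have ki := C0_integrable q1 (Rsq' Rr) ck (C0_sub ck (@subsetT _ _) Ck).
have xi := norm_integrable p1 mp.
have hi' := law_integrable measurable_fst (coupling_law1 pi1)
  (measurable_int _ hi) hi.
have ki' := law_integrable measurable_snd (coupling_law2 pi2)
  (measurable_int _ ki) ki.
have xi' := law_integrable measurable_fst (coupling_law1 pi1)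
  (measurable_int _ xi) xi.
have mD : measurable
    (msupport m `*` msupport r : set (measurableTypeR R * measurableTypeR R)).
  by apply: measurableX; exact: measurable_msupport.
apply: (full_dominated_integrable mD (coupling_msupport pi1 pi2)
  (g := fun z => n%:R * `|z.1| + (h z.1 + k z.2))).
- by apply: measurable_funM; [exact: measurable_fst|exact: measurable_snd].
- have /(integrableD measurableT (integrableZl measurableT n%:R xi')) :=
    integrableD measurableT hi' ki'; exact.
- move=> [x y] [/= mx ry]; have Yy : YR Rs y by exists r.
  have y0 := YR_ge0 Yy; rewrite normrM (ger0_norm y0) [in leLHS](excessE n y0).
  rewrite mulrDr lerD ?hk//.
  by rewrite mulrC ler_wpM2r// ge_min lexx.
Qed.

(** Weak duality is nearly sharp for the monotone coupling of [m] and [r].  The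
    potentials are [potx + h] and [poty + k], where [h] and [k] come from
    [tail_split] and compensate for the truncation of [y] at [n]. *)
Lemma near_optimal r e : Rs r -> 0 < e -> exists f g : R -> R, [/\
  [/\ continuous f, continuous g, C0 p (msupport m) f & C0 q setT g],
  forall x y, msupport m x -> YR Rs y -> x * y <= f x + g y &
  \int[m]_x f x + \int[r]_y g y <=
    \int[quantile_coupling m r]_z ((z.1 : R) * (z.2 : R)) + e].
Proof.
move=> Rr e0; have e8 : 0 < e / 8 by rewrite divr_gt0.
have [n [h [k [[ch ck Ch Ck] he ke hk]]]] :=
  tail_split p1 qp mp Rsq' Rsb Rr e8.
(* [l] is the clamping level, chosen after [n] *)
have [l le] := excess_small p1 mp (divr_gt0 e8 (ltr0Sn R n)).
pose A := \int[m]_x (`|x| + l%:R).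
have A0 : 0 <= A by apply: Rintegral_ge0 => x _; rewrite addr_ge0.
pose K := Num.bound (A / (e / 8)).
have KA : A / (e / 8) < K%:R by apply: archi_boundP; rewrite divr_ge0 ?(ltW e8).
(* the grid has step [d] and [n * K.+1] intervals, so it ends exactly at [n];
   [d] is chosen last, to make its contribution [d * A] small *)
pose d : R := K.+1%:R^-1.
have d0 : 0 <= d by rewrite invr_ge0.
have Nd : (n * K.+1)%:R * d = n%:R by rewrite natrM mulfK.
have dA : d * A <= e / 8.
  rewrite mulrC ler_pdivrMr// mulrC -ler_pdivrMr// (le_trans (ltW KA))//.
  by rewrite ler_nat.
pose X := quantile01 m; pose Y := quantile01 r.
pose D : set R := `]0, 1[%classic.
have Xm u v : D u -> D v -> u <= v -> X u <= X v.
  by rewrite /D/= !in_itv/=; exact: quantile01_mono.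
have Ym u v : D u -> D v -> u <= v -> Y u <= Y v.
  by rewrite /D/= !in_itv/=; exact: quantile01_mono.
have [a [aL aP]] := comonotone_pot Xm Ym (n * K.+1) (ler0n R l) d0.
rewrite Nd in aP.
set f0 := potx d (n * K.+1) a in aP; set g0 := poty d (n * K.+1) a in aP.
have cf0 : continuous f0 by exact: continuous_potx.
have cg0 : continuous g0 by exact: continuous_poty.
have Cf0 : C0 p (msupport m) f0.
  have [C C_ge0 mC] := le_norm_weight p1 mp.
  apply: (@growth_C0 _ _ _ _ (n%:R * (C + l%:R))).
    exact: continuous_subspaceT.
  move=> x mx; apply: le_trans (potx_growth _ _ d0 aL) _.
  rewrite Nd -mulrA ler_wpM2l// mulrDl lerD ?mC//.
  by rewrite ler_peMr// weight_ge1.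
have Cg0 : C0 q setT g0.
  apply: (@growth_C0 _ _ _ _ (n%:R * l%:R)); first exact: continuous_subspaceT.
  move=> y _; apply: le_trans (poty_growth _ _ d0 aL) _.
  by rewrite Nd ler_peMr ?mulr_ge0// weight_ge1.
pose f x := f0 x + h x; pose g y := g0 y + k y.
have cf : continuous f by move=> x; apply: cvgD; [exact: cf0|exact: ch].
have cg : continuous g by move=> x; apply: cvgD; [exact: cg0|exact: ck].
have Chm : C0 p (msupport m) h by exact: C0_sub (@subsetT _ _) Ch.
have Cf : C0 p (msupport m) f by exact: C0D.
have Cg : C0 q setT g by exact: C0D.
exists f, g; split => //.
  move=> x y mx Yy; have y0 := YR_ge0 Yy.
  rewrite [in leLHS](excessE n y0) mulrDr.
  rewrite /f /g addrACA lerD//.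
    by have := @pot_le R d (n * K.+1) a x y d0 y0; rewrite Nd.
  apply: le_trans (hk x y mx Yy); rewrite ler_wpM2r ?excess_ge0//.
  exact: ler_norm.
pose U : Pr R := U01.
have mX : measurable_fun setT X by exact: measurable_quantile.
have mY : measurable_fun setT Y by exact: measurable_quantile.
have lX := @quantile_law R m; have lY := @quantile_law R r.
have hi := C0_integrable p1 mp ch Chm.
have ki := C0_integrable q1 (Rsq' Rr) ck (C0_sub ck (@subsetT _ _) Ck).
have fi := C0_integrable p1 mp cf Cf.
have gi := C0_integrable q1 (Rsq' Rr) cg (C0_sub cg (@subsetT _ _) Cg).
have xi := norm_integrable p1 mp.
have ei : m.-integrable setT (EFin \o excess l).
  apply: (full_dominated_integrable measurableT _ _ xi).
  - by rewrite setCT measure0.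
  - by apply: continuous_measurable_fun; exact: continuous_excess.
  - by move=> x _; rewrite ger0_norm ?excess_ge0// excess_le.
have xli : m.-integrable setT (EFin \o (fun x => `|x| + l%:R : R)).
  apply: (@integrable_add _ _ _ m (fun x => `|x| : R) (fun=> l%:R) xi).
  by apply: finite_measure_integrable_cst.
(* the error depending on [x]; [h] is counted twice, once in the potential and
   once for replacing [X * min n Y] by [X * Y] *)
pose G x := 2 * h x + (n%:R * excess l x + d * (`|x| + l%:R)).
have nedi := integrable_add (integrable_scale n%:R ei) (integrable_scale d xli).
have Gi : m.-integrable setT (EFin \o G).
  exact: (integrable_add (integrable_scale 2 hi) nedi).
have Ge : \int[m]_x G x <= e / 2.
  rewrite RintegralD//; last exact: integrable_scale.
  rewrite RintegralD//; [|exact: integrable_scale|exact: integrable_scale].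
  rewrite !RintegralZl// -/A.
  have : n%:R * \int[m]_x excess l x <= e / 8.
    apply: (@le_trans _ _ (n%:R * (e / 8 / n.+1%:R))); first exact: ler_wpM2l.
    by rewrite mulrA ler_pdivrMr// [leRHS]mulrC ler_pM2r// ler_nat.
  lra.
have k2i := integrable_scale 2 ki.
have k2e : \int[r]_y (2 * k y) <= e / 4 by rewrite RintegralZl//; lra.
have law1 (F : R -> R) : m.-integrable setT (EFin \o F) ->
    U.-integrable setT (EFin \o (fun u => F (X u))).
  by move=> Fi; exact: (law_integrable mX lX (measurable_int _ Fi) Fi).
have law2 (F : R -> R) : r.-integrable setT (EFin \o F) ->
    U.-integrable setT (EFin \o (fun u => F (Y u))).
  by move=> Fi; exact: (law_integrable mY lY (measurable_int _ Fi) Fi).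
have zi := product_integrable Rr (@quantile_coupling_fst R m r)
  (@quantile_coupling_snd R m r).
have XYi : U.-integrable setT (EFin \o (fun u => X u * Y u)).
  exact: (@law_integrable _ _ _ _ _ U (quantile_coupling m r)
    (quantile_pair m r) (measurable_quantile_pair m r) (fun _ _ => erefl) _
    (measurable_int _ zi) zi).
have XYE : \int[U]_u (X u * Y u) =
    \int[quantile_coupling m r]_z ((z.1 : R) * (z.2 : R)).
  exact: (@law_Rintegral _ _ _ _ _ U (quantile_coupling m r)
    (quantile_pair m r) (measurable_quantile_pair m r) (fun _ _ => erefl) _ zi).
have GYi := integrable_add (law1 _ Gi) (law2 _ k2i).
suff : \int[U]_u (f (X u) + g (Y u)) <=
    \int[U]_u (X u * Y u + (G (X u) + 2 * k (Y u))).
  rewrite [leLHS]RintegralD//; [|exact: law1|exact: law2].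
  rewrite [leRHS]RintegralD// XYE.
  rewrite [X in _ <= _ + X -> _]RintegralD//; [|exact: law1|exact: law2 k2i].
  rewrite (law_Rintegral mX lX fi) (law_Rintegral mY lY gi).
  rewrite (law_Rintegral mX lX Gi) (law_Rintegral mY lY k2i).
  by move=> /le_trans; apply; lra.
pose DD : set (measurableTypeR R) :=
  D `&` X @^-1` msupport m `&` Y @^-1` msupport r.
have mD : measurable (D : set (measurableTypeR R)) by exact: measurable_itv.
have mDD : measurable DD.
  apply: measurableI; first apply: measurableI => //.
    rewrite -[Z in measurable Z]setTI.
    by apply: mX => //; exact: measurable_msupport.
  rewrite -[Z in measurable Z]setTI.
  by apply: mY => //; exact: measurable_msupport.
have mCX := measurableC (measurable_msupport m).
have mCY := measurableC (measurable_msupport r).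
have DD0 : U (~` DD) = 0%E.
  apply: measure_negligible; first exact: measurableC.
  rewrite !setCI; apply: negligibleU; first apply: negligibleU.
  - exists (~` D); split => //; [exact: measurableC|exact: U01_full].
  - exists (X @^-1` (~` msupport m)); split => //.
      by rewrite -[Z in measurable Z]setTI; exact: mX.
    exact: (etrans (lX _ mCX) (msupport_full m)).
  - exists (Y @^-1` (~` msupport r)); split => //.
      by rewrite -[Z in measurable Z]setTI; exact: mY.
    exact: (etrans (lY _ mCY) (msupport_full r)).
apply: (full_le_Rintegral mDD DD0).
- by apply: integrable_add; [exact: law1|exact: law2].
- exact: integrable_add.
- move=> u [[Du Xm'] Yr]; have YY : YR Rs (Y u) by exists r.
  have y0 := YR_ge0 YY; have := aP u Du y0; have := hk _ _ Xm' YY.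
  have := ler_wpM2r (excess_ge0 n (Y u)) (ler_norm (- X u)); rewrite normrN.
  rewrite [in X in _ -> _ -> _ -> X](_ : X u * Y u =
    X u * Num.min n%:R (Y u) + X u * excess n (Y u)); last first.
    by rewrite -mulrDr -excessE.
  rewrite /f /g /G -[Num.max 0 (`|X u| - l%:R)]/(excess l (X u)); lra.
Qed.

End Problem.
End Potentials.

(** * Weak and strong duality *)

Section Mixture.
Context {d : measure_display} {T : measurableType d} {R : realType}.
Variables (r0 r1 r : probability T R) (t : R).
Hypothesis t01 : 0 <= t <= 1.
Hypothesis rE : forall A, measurable A ->
  r A = ((1 - t)%:E * r0 A + t%:E * r1 A)%E.

Lemma mixture_ge0_integral (f : T -> \bar R) : measurable_fun setT f ->
  (forall x, 0 <= f x)%E ->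
  (\int[r]_x f x = (1 - t)%:E * \int[r0]_x f x + t%:E * \int[r1]_x f x)%E.
Proof.
move=> mf f0; have /andP[t0 t1] := t01.
have s0 : 0 <= 1 - t by rewrite subr_ge0.
pose k0 : {nonneg R} := NngNum s0; pose k1 : {nonneg R} := NngNum t0.
rewrite (@eq_measure_integral _ _ _ _
  (measure_add (mscale k0 r0) (mscale k1 r1))); last first.
  move=> A mA _; apply: (etrans (rE mA)); apply: esym.
  exact: (measure_addE (mscale k0 r0) (mscale k1 r1) A).
by rewrite ge0_integral_measure_add// !ge0_integral_mscale.
Qed.

(** Reduced to nonnegative functions through [f = (f + |f|) - |f|]. *)
Lemma mixture_Rintegral (f : T -> R) : r0.-integrable setT (EFin \o f) ->
  r1.-integrable setT (EFin \o f) -> r.-integrable setT (EFin \o f) ->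
  \int[r]_x f x = (1 - t) * \int[r0]_x f x + t * \int[r1]_x f x.
Proof.
move=> f0 f1 fr; have mf := measurable_int _ f0.
have ge0 (g : T -> R) : (forall x, 0 <= g x) ->
    r0.-integrable setT (EFin \o g) ->
    r1.-integrable setT (EFin \o g) -> r.-integrable setT (EFin \o g) ->
    \int[r]_x g x = (1 - t) * \int[r0]_x g x + t * \int[r1]_x g x.
  move=> g0 gi0 gi1 gi; apply: EFin_inj.
  rewrite EFinD !EFinM -!Rintegral_EFin//.
  apply: mixture_ge0_integral; last by move=> x; rewrite lee_fin.
  exact: measurable_int gi.
have nfi (P : probability T R) : P.-integrable setT (EFin \o f) ->
    P.-integrable setT (EFin \o (fun x => `|f x|)).
  by move=> /integrable_norm.
have fE (P : probability T R) : P.-integrable setT (EFin \o f) ->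
    \int[P]_x f x = \int[P]_x (f x + `|f x|) - \int[P]_x `|f x|.
  by move=> fi; rewrite RintegralD ?addrK//; exact: nfi.
rewrite !fE// ge0; first rewrite ge0; first by ring.
- by [].
- exact: nfi.
- exact: nfi.
- exact: nfi.
- by move=> x; have := ler_norm (- f x); rewrite normrN; lra.
- by apply: integrable_add => //; exact: nfi.
- by apply: integrable_add => //; exact: nfi.
- by apply: integrable_add => //; exact: nfi.
Qed.

End Mixture.

Section Duality.
Context {R : realType}.
Variables (p q : \bar R) (m : Pr R) (Rs : set (Pr R)).
Hypotheses (p1 : (1 <= p)%E) (qp : q = hoelder_conjugate p) (mp : Pspace p m).
Hypotheses (R0 : Rs !=set0).
Hypotheses (Rsq : Rs `<=` Pspace_pos q) (Rsb : moment_bounded q Rs).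

Let q1 : (1 <= q)%E.
Proof. by rewrite qp hoelder_conj_ge1. Qed.

Let Rsq' : Rs `<=` Pspace q.
Proof. by move=> r /Rsq[]. Qed.

Lemma C0_within_integrable s (mu : Pr R) (Z : set R) f :
  (1 <= s)%E -> Pspace s mu -> msupport mu `<=` Z -> C0 s Z f ->
  mu.-integrable (msupport mu) (EFin \o f).
Proof.
move=> s1 mus muZ Cf; have [C C_ge0 fC] := C0_growth Cf.
have mS := measurable_msupport mu.
have wi := integrable_scale C (weight_integrable s1 mus).
apply: (le_integrable mS _ _ (integrableS measurableT mS (@subsetT _ _) wi)).
  apply/measurable_EFinP; apply: (subspace_continuous_measurable_fun mS).
  by have [cf _] := Cf; exact: continuous_subspaceW cf.
move=> x mx; rewrite /= lee_fin (le_trans (fC _ (muZ _ mx)))//.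
exact: ler_norm.
Qed.

(** The supremum may be uncountable; measurability comes from lower
    semicontinuity. *)
Lemma measurable_conj_fun g :
  measurable_fun [set: measurableTypeR R] (conj_fun Rs g).
Proof.
apply: lower_semicontinuous_measurable => x a /ereal_sup_gt[_ [y Yy <-]].
rewrite lte_fin => axy; exists [set z | a < z * y - g y].
  have cy : {for x, continuous (fun z : R => z * y - g y)}.
    apply: cvgB; last exact: cvg_cst.
    by apply: cvgM; [exact: cvg_id|exact: cvg_cst].
  exact: (cvgr_gt _ cy).
move=> z /= az; apply: (@lt_le_trans _ _ (z * y - g y)%:E).
  by rewrite lte_fin.
by apply: ereal_sup_ubound; exists y.
Qed.

Lemma conj_fun_ge g x y : YR Rs y -> ((x * y - g y)%:E <= conj_fun Rs g x)%E.
Proof. by move=> Yy; apply: ereal_sup_ubound; exists y. Qed.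

Lemma YR_neq0 : YR Rs !=set0.
Proof.
by have [r Rr] := R0; have [y ry] := msupport_neq0 r; exists y, r.
Qed.

Lemma affine_integrable (a b : R) :
  m.-integrable (msupport m) (fun x : R => (x * a - b)%:E).
Proof.
apply: integrableS measurableT (measurable_msupport m) (@subsetT _ _) _.
have xi := integrable_scale a (id_integrable p1 mp).
have ci : m.-integrable setT (EFin \o cst (- b)).
  by apply: finite_measure_integrable_cst.
have := integrable_add xi ci.
by under [X in _.-integrable _ X -> _]eq_fun do rewrite /= mulrC.
Qed.

Lemma Jtilde_le_J fg : Kset p q m Rs fg -> (Jtilde m Rs fg.2 <= J m Rs fg)%E.
Proof.
move=> [Cf Cg fgxy]; have [y0 Yy0] := YR_neq0.
have fi := C0_within_integrable p1 mp (@subset_refl _ _) Cf.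
have conj_le x : msupport m x -> (conj_fun Rs fg.2 x <= (fg.1 x)%:E)%E.
  move=> mx; apply: ge_ereal_sup => _ [y Yy <-].
  by rewrite lee_fin lerBlDr fgxy.
have li := affine_integrable y0 (fg.2 y0).
have mS := measurable_msupport m.
apply: leeD2r; apply: le_integral => //; last first.
  by move=> x /set_mem; exact: conj_le.
have := integrableD mS (integrable_abse li) (integrable_abse fi).
apply: le_integrable => //.
  exact: measurable_funTS (measurable_conj_fun _).
move=> x mx; have := conj_le x mx; have := conj_fun_ge fg.2 x Yy0.
case: (conj_fun Rs fg.2 x) => //= z; rewrite !lee_fin => lz zf.
rewrite (ger0_norm (addr_ge0 (normr_ge0 _) (normr_ge0 _))).
have := ler_norm (fg.1 x); have := ler_norm (- (x * y0 - fg.2 y0)).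
rewrite normrN => ? ?.
have := normr_ge0 (fg.1 x); have := normr_ge0 (x * y0 - fg.2 y0) => ? ?.
by rewrite ler_norml; apply/andP; split; lra.
Qed.

(** With an integrable lower bound, the integral can only be infinite because
    of the positive part. *)
Lemma integrable_lower (mu : Pr R) (D : set (measurableTypeR R))
    (l f : R -> \bar R) : measurable D -> measurable_fun D f ->
  mu.-integrable D l -> (forall x, D x -> l x <= f x)%E ->
  (\int[mu]_(x in D) f x < +oo)%E -> mu.-integrable D f.
Proof.
move=> mD mf li lf fy.
have fni : mu.-integrable D (f^\-)%E.
  apply: (le_integrable mD _ _ li); first exact: measurable_funeneg.
  move=> x Dx; rewrite gee0_abs ?funeneg_ge0// funenegE ge_max abse_ge0 andbT.
  apply: (@le_trans _ _ (- l x)%E); first by rewrite leeN2 lf.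
  by rewrite -abseN lee_abs.
have fpi : mu.-integrable D (f^\+)%E.
  apply/integrableP; split; first exact: measurable_funepos.
  under eq_integral do rewrite gee0_abs ?funepos_ge0//.
  rewrite ltey; apply/eqP => fpy; move: fy; rewrite integralE fpy.
  by rewrite -(fineK (integrable_fin_num mD fni)).
rewrite [f]funeposneg; exact: integrableB.
Qed.

Lemma chi_le_Jtilde g : C0 q (YR Rs) g -> (chi Rs m <= Jtilde m Rs g)%E.
Proof.
move=> Cg; apply: ge_ereal_sup => _ [pi [pi1 [r Rr pi2]] <-].
have mS := measurable_msupport m; have mT := measurable_msupport r.
have rY : msupport r `<=` YR Rs by move=> y ry; exists r.
have gi := C0_within_integrable q1 (Rsq' Rr) rY Cg.
have le_sigma : (\int[r]_(y in msupport r) (g y)%:E <= sigmaR Rs g)%E.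
  by apply: ereal_sup_ubound; exists r.
have gfin := integrable_fin_num mT gi.
have [conj_lty|conj_y] :=
  ltP (\int[m]_(x in msupport m) conj_fun Rs g x)%E +oo%E; last first.
  rewrite /Jtilde; move: conj_y; rewrite leye_eq => /eqP ->.
  rewrite addye ?leey// gt_eqF// (lt_le_trans _ le_sigma)//.
  by rewrite ltNye_eq gfin.
apply: le_trans (leeD (lexx _) le_sigma).
have [y0 Yy0] := YR_neq0.
have ci : m.-integrable (msupport m) (conj_fun Rs g).
  apply: (integrable_lower mS _ (affine_integrable y0 (g y0))) => //.
    exact: measurable_funTS (measurable_conj_fun _).
  by move=> x _; exact: conj_fun_ge.
pose G1 := (conj_fun Rs g : measurableTypeR R -> \bar R) \_ (msupport m).
pose G2 := (EFin \o g : measurableTypeR R -> \bar R) \_ (msupport r).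
have i1 : m.-integrable setT G1 := (integrable_mkcond _ mS).1 ci.
have i2 : r.-integrable setT G2 := (integrable_mkcond _ mT).1 gi.
have i1' := law_integrable measurable_fst (coupling_law1 pi1)
  (measurable_int _ i1) i1.
have i2' := law_integrable measurable_snd (coupling_law2 pi2)
  (measurable_int _ i2) i2.
have zi := product_integrable p1 qp mp Rsq Rsb Rr pi1 pi2.
rewrite [X in (_ <= X + _)%E]integral_mkcond.
rewrite [X in (_ <= _ + X)%E]integral_mkcond.
rewrite -/G1 -/G2.
rewrite -(law_integral measurable_fst (coupling_law1 pi1)
  (measurable_int _ i1) i1).
rewrite -(law_integral measurable_snd (coupling_law2 pi2)
  (measurable_int _ i2) i2).
rewrite -integralD//.
have mD : measurable
    (msupport m `*` msupport r : set (measurableTypeR R * measurableTypeR R)).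
  by apply: measurableX; exact: measurable_msupport.
have i12 := integrableD measurableT i1' i2'.
rewrite -(full_integral mD (coupling_msupport pi1 pi2) zi).
rewrite -(full_integral mD (coupling_msupport pi1 pi2) i12).
apply: le_integral => //; [exact: integrableS zi|exact: integrableS i12|].
move=> [x y] /set_mem[/= mx ry]; rewrite /G1 /G2 !patchE !mem_set//=.
have := conj_fun_ge g x (rY _ ry).
case: (conj_fun Rs g x) => //= z; rewrite -?EFinD ?lee_fin ?addye ?leey//.
lra.
Qed.

Lemma msupport_integral s (mu : Pr R) (f : R -> R) : (1 <= s)%E ->
  Pspace s mu -> continuous f -> C0 s (msupport mu) f ->
  (\int[mu]_(x in msupport mu) (f x)%:E = (\int[mu]_x f x)%:E)%E.
Proof.
move=> s1 mus cf Cf; have fi := C0_integrable s1 mus cf Cf.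
rewrite (full_integral (measurable_msupport mu) (msupport_full mu) fi).
exact: Rintegral_EFin.
Qed.

(** The second component is continuous with controlled growth on the whole line,
    not just on [YR Rs], so that it is a test function for the weak-star
    topology. *)
Definition global_pair (fg : (R -> R) * (R -> R)) := [/\
  [/\ continuous fg.1, continuous fg.2,
      C0 p (msupport m) fg.1 & C0 q setT fg.2] &
  forall x y, msupport m x -> YR Rs y -> x * y <= fg.1 x + fg.2 y].

(** Equality is only required on [Rs], where all integrals converge; this makes
    the family closed under convex combinations. *)
Definition value_family : set (Pr R -> R) := [set phi |
  exists2 fg, global_pair fg &
    forall r, Rs r -> phi r = \int[m]_x fg.1 x + \int[r]_y fg.2 y].

Let C0T r (g : R -> R) : continuous g -> C0 q setT g -> C0 q (msupport r) g.
Proof. by move=> cg; exact: C0_sub (@subsetT _ _). Qed.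

Let gint r (g : R -> R) : Rs r -> continuous g -> C0 q setT g ->
  r.-integrable setT (EFin \o g).
Proof.
by move=> Rr cg Cg; apply: (C0_integrable q1 (Rsq' Rr) cg); exact: C0T.
Qed.

Lemma value_affine : convex_measures Rs -> affine_on Rs value_family.
Proof.
move=> Rcvx r0 r1 t Rr0 Rr1 t01; have [r Rr rE] := Rcvx _ _ _ Rr0 Rr1 t01.
exists r => // phi [[f g] [[cf cg Cf Cg] _] phiE]; rewrite !phiE//=.
by rewrite (mixture_Rintegral t01 rE); [ring|exact: gint..].
Qed.

Lemma value_convex : convex_family value_family.
Proof.
move=> phi psi t [[f g] [[cf cg Cf Cg] fgxy] phiE].
move=> [[f' g'] [[cf' cg' Cf' Cg'] fgxy'] psiE] /andP[t0 t1]; simpl in *.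
have s0 : 0 <= 1 - t by rewrite subr_ge0.
exists (fun x => (1 - t) * f x + t * f' x, fun y => (1 - t) * g y + t * g' y).
  split; first split.
  - by move=> x; apply: cvgD; exact: continuous_scale.
  - by move=> x; apply: cvgD; exact: continuous_scale.
  - by apply: C0D; do ?exact: continuous_scale; exact: C0Z.
  - by apply: C0D; do ?exact: continuous_scale; exact: C0Z.
  - move=> x y mx Yy /=.
    have := ler_wpM2l s0 (fgxy _ _ mx Yy).
    by have := ler_wpM2l t0 (fgxy' _ _ mx Yy); lra.
have fi := C0_integrable p1 mp cf Cf; have fi' := C0_integrable p1 mp cf' Cf'.
move=> r Rr; rewrite phiE// psiE//=.
have gi := gint Rr cg Cg; have gi' := gint Rr cg' Cg'.
rewrite !RintegralD//; try exact: integrable_scale.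
by rewrite !RintegralZl//; ring.
Qed.

Lemma chi_ge r : Rs r ->
  ((\int[quantile_coupling m r]_z ((z.1 : R) * (z.2 : R)))%:E <= chi Rs m)%E.
Proof.
move=> Rr; apply: ereal_sup_ubound; exists (quantile_coupling m r).
  split; first exact: quantile_coupling_fst.
  by exists r => //; exact: quantile_coupling_snd.
rewrite Rintegral_EFin//.
by apply: (product_integrable p1 qp mp Rsq Rsb Rr);
  [exact: quantile_coupling_fst|exact: quantile_coupling_snd].
Qed.

(** A real [c] strictly between both sides leads to a contradiction: by minimax
    and compactness some [r] in [Rs] has value at least [c] against every global
    pair, whereas [near_optimal] yields a pair whose value at [r] is below
    [c]. *)
Lemma inf_J_le_chi : convex_measures Rs -> weakstar_closed q Rs ->
  (ereal_inf [set J m Rs fg | fg in Kset p q m Rs] <= chi Rs m)%E.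
Proof.
move=> Rcvx Rcl; rewrite leNgt; apply/negP => gap.
have [r0 Rr0] := R0; have chi_r0 := chi_ge Rr0.
have chi_fin : chi Rs m \is a fin_num.
  rewrite fin_numElt (lt_le_trans (ltNyr _) chi_r0)/=.
  exact: lt_le_trans gap (leey _).
have [c chic cinf] : exists2 c : R, fine (chi Rs m) < c &
    (c%:E < ereal_inf [set J m Rs fg | fg in Kset p q m Rs])%E.
  move: gap; rewrite -{1}(fineK chi_fin); set a := fine _.
  case: (ereal_inf _) => [b| |]//.
    rewrite lte_fin => ab; exists ((a + b) / 2); rewrite ?lte_fin; lra.
  by move=> _; exists (a + 1); rewrite ?ltrDl// ltry.
have val_gt phi : value_family phi -> exists2 r, Rs r & c < phi r.
  move=> [[f g] [[cf cg Cf Cg] fgxy] phiE]; simpl in *.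
  have : (c%:E < J m Rs (f, g))%E.
    apply: lt_le_trans cinf _; apply: ereal_inf_lbound; exists (f, g) => //.
    split => //=; exact: C0_sub cg (@subsetT _ _) Cg.
  rewrite /J/= (msupport_integral p1 mp cf Cf) -lteBlDl//.
  move=> /ereal_sup_gt[_ [r Rr <-]].
  rewrite (msupport_integral q1 (Rsq' Rr) cg (C0T r cg Cg)) -EFinB lte_fin.
  move=> cg'.
  by exists r; rewrite // phiE//= -ltrBlDl.
have [r Rr rc] : exists2 r, Rs r & forall phi, value_family phi -> c <= phi r.
  apply: (measure_FIP q1 Rsq' Rsb Rcl).
    move=> phi [[f g] [[cf cg Cf Cg] _] phiE].
    exists (\int[m]_x f x), (MkC0R (mem_set Cg : g \in C0pred q)) => r Rr.
    by rewrite phiE.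
  move=> n phis Fphis.
  exact: (minimax_finite R0 (value_affine Rcvx) value_convex val_gt Fphis).
have e0 : 0 < (c - fine (chi Rs m)) / 2 by lra.
have [f [g [Cfg fgxy le_e]]] := near_optimal p1 qp mp Rsq Rsb Rr e0.
have : c <= \int[m]_x f x + \int[r]_y g y.
  apply: (rc (fun r => \int[m]_x f x + \int[r]_y g y)).
  by exists (f, g) => //; split.
have := chi_ge Rr; rewrite -{1}(fineK chi_fin) lee_fin; lra.
Qed.

Lemma inf_Jtilde_le_inf_J :
  (ereal_inf [set Jtilde m Rs g | g in C0 q (YR Rs)] <=
   ereal_inf [set J m Rs fg | fg in Kset p q m Rs])%E.
Proof.
apply: le_ereal_inf_tmp => _ [fg Kfg <-]; apply: ge_ereal_inf.
exists (Jtilde m Rs fg.2); last exact: Jtilde_le_J.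
by exists fg.2 => //; case: Kfg.
Qed.

Lemma chi_le_inf_Jtilde :
  (chi Rs m <= ereal_inf [set Jtilde m Rs g | g in C0 q (YR Rs)])%E.
Proof. by apply: le_ereal_inf_tmp => _ [g Cg <-]; exact: chi_le_Jtilde. Qed.

End Duality.

Unset Implicit Arguments.
Set Strict Implicit.

Theorem theorem5p1 (R : realType) (p q : \bar R) (m : Pr R) (Rs : set (Pr R)) :
  (1 <= p)%E -> q = hoelder_conjugate p ->
  Pspace p m ->
  Rs !=set0 -> Rs `<=` Pspace_pos q -> moment_bounded q Rs ->
  ((chi Rs m <= ereal_inf [set Jtilde m Rs g | g in C0 q (YR Rs)])%E /\
   (ereal_inf [set Jtilde m Rs g | g in C0 q (YR Rs)] <=
    ereal_inf [set J m Rs fg | fg in Kset p q m Rs])%E) /\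
  (convex_measures Rs -> weakstar_closed q Rs ->
   [/\ chi Rs m = ereal_inf [set Jtilde m Rs g | g in C0 q (YR Rs)],
       ereal_inf [set Jtilde m Rs g | g in C0 q (YR Rs)] =
       ereal_inf [set J m Rs fg | fg in Kset p q m Rs] &
       forall f g : R -> R,
         minimizer (J m Rs) (Kset p q m Rs) (f, g) ->
         minimizer (Jtilde m Rs) (C0 q (YR Rs)) g]).
Proof.
move=> p1 qp mp R0 Rsq Rsb.
have weak1 := chi_le_inf_Jtilde p1 qp mp R0 Rsq Rsb.
have weak2 := inf_Jtilde_le_inf_J q p1 mp R0.
split => // Rcvx Rcl.
have strong := inf_J_le_chi p1 qp mp R0 Rsq Rsb Rcvx Rcl.
have chi_eq : chi Rs m = ereal_inf [set Jtilde m Rs g | g in C0 q (YR Rs)].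
  by apply/eqP; rewrite eq_le weak1 (le_trans weak2 strong).
have inf_eq : ereal_inf [set Jtilde m Rs g | g in C0 q (YR Rs)] =
    ereal_inf [set J m Rs fg | fg in Kset p q m Rs].
  by apply/eqP; rewrite eq_le weak2 (le_trans strong weak1).
split => // f g [Kfg Jmin]; split; first by case: Kfg.
move=> g' Cg'; apply: le_trans (Jtilde_le_J p1 mp R0 Kfg) _.
apply: (@le_trans _ _ (ereal_inf [set J m Rs fg | fg in Kset p q m Rs])).
  by apply: le_ereal_inf_tmp => _ [fg Kfg' <-]; exact: Jmin.
by rewrite -inf_eq; apply: ereal_inf_lbound; exists g'.
Qed.
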